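(* Let $G \subseteq W = (\mathbb{Z}/2\mathbb{Z})^4 \rtimes S_5$ be a subgroup and assume that $H^1(G,\mathfrak{P})$ contains an element of order exactly $4$. a) Then $G$ is of type I or of type II. b) If $G$ is of type II and has order four then $G$ is of type I as well. There is no further overlap between the two types: if $G$ is of both types then $G$ is of order four. c) One has $H^1(G,\mathfrak{P}) \cong \mathbb{Z}/4\mathbb{Z}\oplus(\mathbb{Z}/2\mathbb{Z})^e$, for $e=0$, $1$, or $2$. If $G$ is of type II then $e\le 1$. In particular, $H^1(G,\mathfrak{P})/H^1(G,\mathfrak{P})_2$ (where $H^1(G,\mathfrak{P})_2$ is the $2$-torsion subgroup) is of order $2$. It is generated by the class of $\alpha=\iota_{\mathrm{Pic},4}(\overline{[e_1]+[e_2]+[e_3]+2[e_4]})$ when $G$ is of type I and normalised as in the definition of type I, and by the class of $\alpha=\iota_{\mathrm{Pic},4}(\overline{[e_1]+2[e_2]+2[e_4]})$ when $G$ is of type II and normalised as in the definition of type II.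
   Context: $W = (\mathbb{Z}/2\mathbb{Z})^4 \rtimes S_5$, where $(\mathbb{Z}/2\mathbb{Z})^4$ denotes $\{(a_1,\ldots,a_5) \in (\mathbb{Z}/2\mathbb{Z})^5 \mid a_1+\cdots+a_5=0\}$, acted upon by $S_5$ by permuting coordinates. $P$ is the free abelian group on the symbols $[e_1],\ldots,[e_5]$, and $\mathfrak{P} \subset P\otimes_{\mathbb{Z}}\mathbb{Q}$ is the subgroup generated by $P$ and the element $\frac12([e_1]+\cdots+[e_5])$. The group $W$ acts on $\mathfrak{P}$: $S_5$ permutes the indices and $(a_1,\ldots,a_5)$ sends $[e_i]$ to $(-1)^{a_i}[e_i]$. Let $p\colon W\to S_5$ be the natural projection. $\iota_{\mathrm{Pic},4}\colon(\mathfrak{P}/4\mathfrak{P})^G\to H^1(G,\mathfrak{P})$ is the connecting homomorphism associated with $0\to\mathfrak{P}\xrightarrow{\cdot4}\mathfrak{P}\to\mathfrak{P}/4\mathfrak{P}\to0$; i.e. $\iota_{\mathrm{Pic},4}(\overline{c})$ is the class of $\sigma\mapsto\frac14(\sigma(c)-c)$, bars denoting residue classes modulo $4\mathfrak{P}$. Type I. Let $\tau\in W$ be the element of order $4$ acting by $[e_4]\mapsto[e_5]\mapsto-[e_4]$ and $[e_i]\mapsto-[e_i]$ for $i=1,2,3$. Let $S_3\subset W$ act by permuting $[e_1],[e_2],[e_3]$ and fixing $[e_4],[e_5]$. These commute and generate a subgroup $S_3\times\langle\tau\rangle\cong S_3\times\mathbb{Z}/4\mathbb{Z}$ of $W$.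 A subgroup $G$ is (normalised) of type I if $G\subseteq S_3\times\langle\tau\rangle$ and $G$ surjects onto $\langle\tau\rangle$ under the projection. Type II. A subgroup $G$ is (normalised) of type II if (i) $p(G)$ stabilises $1$ and every $\sigma\in G$ satisfies $p(\sigma)(\{2,4\})=\{2,4\}$ or $p(\sigma)(\{2,4\})=\{3,5\}$; (ii) for $\sigma\in G$, $p(\sigma)$ interchanges $\{2,4\}$ and $\{3,5\}$ if and only if $\sigma([e_1])=-[e_1]$; and (iii) $\sigma([e_1])=-[e_1]$ for some $\sigma\in G$. In general, a subgroup of $W$ is said to be of type I or II if it is conjugate in $W$ to a normalised one. *)

(* Defs.v *)
From HB Require Import structures.
From mathcomp Require Import all_boot all_order all_fingroup all_algebra.
From mathcomp Require Import generic_quotient ring_quotient.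
From mathcomp Require Import boolp ring.

Set Implicit Arguments.
Unset Strict Implicit.
Unset Printing Implicit Defensive.

Import GRing.Theory Num.Theory.

Local Open Scope ring_scope.
Local Open Scope quotient_scope.

Section ZmoduleNotions.

Variable A : zmodType.
Implicit Types (x : A) (n : nat).

Definition has_order x n : Prop :=
  [/\ (0 < n)%N, x *+ n = 0 & forall m, (0 < m < n)%N -> x *+ m <> 0].

Definition torsion n x : bool := x *+ n == 0.

Lemma torsion_zmod_closed n : zmod_closed (torsion n).
Proof.
split=> [|x y]; rewrite !unfold_in ?mul0rn // => /eqP xn0 /eqP yn0.
by rewrite mulrnBl xn0 yn0 subrr.
Qed.

HB.instance Definition _ n :=
  GRing.isZmodClosed.Build A (torsion n) (torsion_zmod_closed n).

Definition torsion_sub n : zmodClosed A :=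
  GRing.ZmodClosed.clone A (torsion n) _.

Definition multiples n x : bool := `[< exists y, x = y *+ n >].

Lemma multiples_zmod_closed n : zmod_closed (multiples n).
Proof.
split=> [|x y]; first by apply/asboolP; exists 0; rewrite mul0rn.
move=> /asboolP[u ->] /asboolP[v ->]; apply/asboolP.
by exists (u - v); rewrite mulrnBl.
Qed.

HB.instance Definition _ n :=
  GRing.isZmodClosed.Build A (multiples n) (multiples_zmod_closed n).

Definition multiples_sub n : zmodClosed A :=
  GRing.ZmodClosed.clone A (multiples n) _.

End ZmoduleNotions.

Definition zmod_card (A : zmodType) (n : nat) : Prop :=
  exists f : A -> 'I_n, bijective f.

Definition zmod_iso (A B : zmodType) : Prop :=
  exists phi : {additive A -> B}, bijective phi.

Section FirstCohomology.

Variables (gT : finGroupType) (G : {group gT}) (M : zmodType).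
Variable act : gT -> {additive M -> M}.

(* [act] is meant to be a left action for composition.  Products in [gT] are
   read from left to right, as in {perm _}: s composed with t is [t * s], so
   that act (t * s) = act s \o act t, and the cocycle condition
   f (s o t) = f s + s (f t) takes the form below. *)
Definition cocycle (f : {ffun subg_of G -> M}) : bool :=
  [forall s, forall t, f (t * s)%g == f s + act (sgval s) (f t)].

Lemma cocycle_zmod_closed : zmod_closed cocycle.
Proof.
split=> [|f g]; rewrite ?unfold_in.
  by apply/'forall_forallP => s t; rewrite !ffunE raddf0 addr0.
move=> /'forall_'forall_eqP fZ /'forall_'forall_eqP gZ.
apply/'forall_'forall_eqP => s t.
by rewrite !ffunE fZ gZ raddfB opprD addrACA.
Qed.

HB.instance Definition _ :=
  GRing.isZmodClosed.Build {ffun subg_of G -> M} cocycle cocycle_zmod_closed.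

Record Z1 := MkZ1 { cochain_of_Z1 :> {ffun subg_of G -> M};
                    _ : cochain_of_Z1 \in cocycle }.

HB.instance Definition _ := [isSub for cochain_of_Z1].
HB.instance Definition _ := [Choice of Z1 by <:].
HB.instance Definition _ := [SubChoice_isSubZmodule of Z1 by <:].

Definition coboundary (f : Z1) : bool :=
  `[< exists m : M, forall s, f s = act (sgval s) m - m >].

Lemma coboundary_zmod_closed : zmod_closed coboundary.
Proof.
split=> [|f g].
  by apply/asboolP; exists 0 => s; rewrite raddf0 subrr [LHS]ffunE.
move=> /asboolP[m fB] /asboolP[n gB]; apply/asboolP; exists (m - n) => s.
by rewrite !ffunE fB gB (raddfB (act _)) !opprD addrACA.
Qed.

HB.instance Definition _ :=
  GRing.isZmodClosed.Build Z1 coboundary coboundary_zmod_closed.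

Definition B1 : zmodClosed Z1 := GRing.ZmodClosed.clone Z1 coboundary _.

Definition H1 : zmodType := Quotient.quot B1.

End FirstCohomology.

Arguments has_order {A} x n.
Arguments torsion_sub A n : clear implicits.
Arguments multiples_sub A n : clear implicits.

Definition permute_signs (a : 'rV['Z_2]_5) (s : 'S_5) : 'rV['Z_2]_5 :=
  col_perm s^-1 a.

Lemma permute_signs1 : permute_signs^~ 1%g =1 id.
Proof. by move=> a; rewrite /permute_signs invg1 col_perm1. Qed.

Lemma permute_signsM a : act_morph permute_signs a.
Proof. by move=> s t; rewrite /permute_signs invMg col_permM. Qed.

Canonical signs_action := TotalAction permute_signs1 permute_signsM.

Lemma signs_is_groupAction : is_groupAction [set: 'rV['Z_2]_5] signs_action.
Proof.
move=> s _; rewrite inE; apply/andP; split.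
  by apply/subsetP => a _; rewrite inE.
apply/morphicP => a b _ _; rewrite !actpermE /=.
by apply/rowP => i; rewrite !mxE.
Qed.

Canonical signs_groupAction := GroupAction signs_is_groupAction.

Definition even_signs : {set 'rV['Z_2]_5} :=
  [set a : 'rV['Z_2]_5 | \sum_i a 0 i == 0].

Lemma even_signs_group_set : group_set even_signs.
Proof.
apply/group_setP; split.
  by rewrite inE; apply/eqP/big1 => i _; rewrite mxE.
move=> a b; rewrite !inE => /eqP a0 /eqP b0.
under eq_bigr do rewrite mxE.
by rewrite big_split /= a0 b0 addr0.
Qed.

Canonical even_signs_group := Group even_signs_group_set.

Lemma even_signs_acts :
  {acts [set: 'S_5], on group even_signs_group | signs_groupAction}.
Proof.
split; last exact: subsetT.
apply/subsetP => s _; rewrite !inE /=; apply/subsetP => a.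
rewrite !inE => /eqP a0; apply/eqP; rewrite -[RHS]a0.
rewrite [RHS](reindex_inj (@perm_inj _ s^-1%g)) /=.
by apply: eq_bigr => i _; rewrite mxE.
Qed.

(* An element of [W] is a pair (s, a) with s : 'S_5 and a even; it stands for
   the map "first s, then a". *)
Definition W : finGroupType := sdprod_by <[even_signs_acts]>%gact.

Definition W_perm (s : 'S_5) : W := sdpair2 <[even_signs_acts]>%gact s.
Definition W_sign (a : 'rV['Z_2]_5) : W := sdpair1 <[even_signs_acts]>%gact a.

Definition proj (w : W) : 'S_5 := w.1.
Definition sign (w : W) : 'rV['Z_2]_5 := w.2.

Lemma projM (v w : W) : proj (v * w)%g = (proj v * proj w)%g.
Proof. by []. Qed.

Lemma signM (v w : W) i :
  sign (v * w)%g 0 i = sign v 0 ((proj w)^-1%g i) + sign w 0 i.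
Proof.
case: v w => [[s a] sa] [[t b] sb]; have /setXP[_ ea] := sa.
by rewrite /sign /= [LHS]mxE /= /actby ea inE /= mxE.
Qed.

Lemma proj_W_perm s : proj (W_perm s) = s.
Proof. by rewrite /proj /W_perm val_insubd in_setX in_setT group1. Qed.

Lemma sign_W_perm s : sign (W_perm s) = 0.
Proof. by rewrite /sign /W_perm val_insubd in_setX in_setT group1. Qed.

Lemma proj_W_sign a : proj (W_sign a) = 1%g.
Proof. by rewrite /proj /W_sign val_insubd; case: ifP. Qed.

Lemma sign_W_sign a : a \in even_signs -> sign (W_sign a) = a.
Proof. by move=> ea; rewrite /sign /W_sign val_insubd in_setX ea inE. Qed.

(* P (x) QQ is 'rV[rat]_5, with [e_i] the i-th unit vector. *)
Definition lattice (v : 'rV[rat]_5) : bool :=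
  `[< exists (u : 'rV[int]_5) (k : int),
        v = map_mx intr u + (2%:R^-1 *: \sum_i delta_mx 0 i) *~ k >].

Lemma lattice_zmod_closed : zmod_closed lattice.
Proof.
split=> [|v w].
  by apply/asboolP; exists 0, 0; rewrite raddf0 mulr0z addr0.
move=> /asboolP[u [k ->]] /asboolP[u' [k' ->]].
apply/asboolP; exists (u - u'), (k - k').
by rewrite raddfB mulrzBr opprD addrACA.
Qed.

HB.instance Definition _ :=
  GRing.isZmodClosed.Build 'rV[rat]_5 lattice lattice_zmod_closed.

Record Pic := MkPic { row_of_Pic :> 'rV[rat]_5;
                      _ : row_of_Pic \in lattice }.

HB.instance Definition _ := [isSub for row_of_Pic].
HB.instance Definition _ := [Choice of Pic by <:].
HB.instance Definition _ := [SubChoice_isSubZmodule of Pic by <:].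

Lemma basis_in_lattice (i : 'I_5) : delta_mx 0 i \in lattice.
Proof.
by apply/asboolP; exists (delta_mx 0 i), 0; rewrite map_delta_mx mulr0z addr0.
Qed.

Definition e_ (i : 'I_5) : Pic := MkPic (basis_in_lattice i).

Definition W_actQ (w : W) (v : 'rV[rat]_5) : 'rV[rat]_5 :=
  \row_i ((-1) ^+ sign w 0 i * v 0 ((proj w)^-1%g i)).

Lemma W_actQ_additive w : zmod_morphism (W_actQ w).
Proof. by move=> u v; apply/rowP => i; rewrite !mxE mulrBr. Qed.

HB.instance Definition _ w :=
  GRing.isZmodMorphism.Build 'rV[rat]_5 'rV[rat]_5 (W_actQ w)
    (W_actQ_additive w).

Lemma W_actQ_lattice w v : v \in lattice -> W_actQ w v \in lattice.
Proof.
move=> /asboolP[u [k ->]].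
apply/asboolP.
exists (\row_i ((-1) ^+ sign w 0 i * u 0 ((proj w)^-1%g i)
                - (sign w 0 i : nat)%:Z * k)), k.
have sumE i : (\sum_(j < 5) delta_mx 0 j : 'rV[rat]_5) 0 i = 1.
  rewrite summxE (bigD1 i) //= big1 => [|j ji]; first by rewrite mxE !eqxx addr0.
  by rewrite mxE eq_sym (negPf ji) andbF.
apply/rowP => i; rewrite -scaler_int !mxE !sumE.
case: (sign w 0 i) => [[|[|//]] ?] /=.
  by rewrite !expr0 !mul1r mul0r subr0.
rewrite !expr1 mul1r !mulN1r rmorphB rmorphN /=.
by field.
Qed.

Definition W_act (w : W) (c : Pic) : Pic :=
  MkPic (W_actQ_lattice w (valP c)).

Lemma W_act_additive w : zmod_morphism (W_act w).
Proof. by move=> b c; apply: val_inj; rewrite /= raddfB. Qed.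

HB.instance Definition _ w :=
  GRing.isZmodMorphism.Build Pic Pic (W_act w) (W_act_additive w).

Lemma W_act1 : W_act 1%g =1 id.
Proof.
move=> c; apply/val_inj/rowP => i.
by rewrite !mxE /proj /= invg1 perm1 mul1r.
Qed.

Lemma W_actM v w c : W_act (w * v)%g c = W_act v (W_act w c).
Proof.
apply/val_inj/rowP => i.
rewrite /= ![W_actQ _ _ _ _]mxE signM projM invMg permM mulrA -exprD.
congr (_ * _).
by case: (sign v 0 i) (sign w 0 _) => [[|[|//]] ?] [[|[|//]] ?].
Qed.

Lemma W_act_perm s i : W_act (W_perm s) (e_ i) = e_ (s i).
Proof.
apply/val_inj/rowP => j.
rewrite !mxE sign_W_perm proj_W_perm mxE expr0 mul1r.
by rewrite (canF_eq (permKV s)).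
Qed.

Lemma W_act_sign a i :
  a \in even_signs -> W_act (W_sign a) (e_ i) = e_ i *~ (-1) ^+ a 0 i.
Proof.
move=> ea; apply/val_inj/rowP => j.
rewrite raddfMz /= -scaler_int !mxE proj_W_sign invg1 perm1 (sign_W_sign ea).
by rewrite rmorphXn /= rmorphN1; case: eqP => [->|_] //; rewrite !mulr0.
Qed.

Definition Pic_mod4 : zmodType := Quotient.quot (multiples_sub Pic 4).

Definition W_act_mod4 (w : W) : Pic_mod4 -> Pic_mod4 :=
  lift_op1 Pic_mod4 (W_act w).

Lemma pi_W_act_mod4 w (c : Pic) :
  W_act_mod4 w (\pi_Pic_mod4 c) = \pi_Pic_mod4 (W_act w c).
Proof.
rewrite /W_act_mod4; unlock; apply/eqP; rewrite -Quotient.idealrBE -raddfB.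
have : repr (\pi_Pic_mod4 c) - c \in multiples_sub Pic 4.
  by rewrite Quotient.idealrBE reprK.
by move=> /asboolP[b ->]; apply/asboolP; exists (W_act w b); rewrite raddfMn.
Qed.

(* Division by 4 in P (x) QQ; the value is junk (0) outside 4 * Pic. *)
Definition quarter (c : Pic) : Pic := insubd 0 (4%:R^-1 *: \val c).

Lemma quarterE c : quarter (c *+ 4) = c.
Proof.
apply: val_inj; rewrite val_insubd raddfMn /= -scaler_nat scalerA mulVf //.
by rewrite scale1r (valP c).
Qed.

Section Iota.

Variable G : {group W}.

Definition invariant4 (x : Pic_mod4) : bool :=
  [forall s in G, W_act_mod4 s x == x].

(* (Pic / 4 Pic)^G *)
Definition Pic_mod4_inv := {x : Pic_mod4 | invariant4 x}.

Definition iota_cochain (c : Pic) : {ffun subg_of G -> Pic} :=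
  [ffun s => quarter (W_act (sgval s) c - c)].

Lemma iota_cochainE (c : Pic) : invariant4 (\pi_Pic_mod4 c) ->
  forall s, W_act (sgval s) c - c = iota_cochain c s *+ 4.
Proof.
move=> /forall_inP cG s; rewrite ffunE.
have /eqP := cG _ (valP s); rewrite pi_W_act_mod4 => /eqP.
by rewrite -Quotient.idealrBE => /asboolP[b ->]; rewrite quarterE.
Qed.

Lemma mulr4_inj : injective (fun c : Pic => c *+ 4).
Proof. by move=> b c bc; rewrite -[b]quarterE bc quarterE. Qed.

Lemma iota_cochain_cocycle (c : Pic) : invariant4 (\pi_Pic_mod4 c) ->
  iota_cochain c \in @cocycle _ G _ W_act.
Proof.
move=> cG; apply/'forall_'forall_eqP => s t; apply: mulr4_inj.
rewrite /= mulrnDl -raddfMn -!iota_cochainE //= W_actM raddfB.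
by rewrite [RHS]addrC addrA subrK.
Qed.

Lemma invariant4_repr (x : Pic_mod4_inv) : invariant4 (\pi_Pic_mod4 (repr (\val x))).
Proof. by rewrite reprK (valP x). Qed.

Definition iota_Pic4 (x : Pic_mod4_inv) : H1 G W_act :=
  \pi_(H1 G W_act) (MkZ1 (iota_cochain_cocycle (invariant4_repr x))).

Lemma iota_Pic4E (c : Pic) (cG : invariant4 (\pi_Pic_mod4 c)) :
  iota_Pic4 (exist _ (\pi_Pic_mod4 c) cG) = \pi_(H1 G W_act) (MkZ1 (iota_cochain_cocycle cG)).
Proof.
apply/eqP; rewrite -Quotient.idealrBE /=.
set c' := repr _.
have c'G : invariant4 (\pi_Pic_mod4 c') by rewrite reprK.
have : c' - c \in multiples_sub Pic 4 by rewrite Quotient.idealrBE reprK.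
move=> /asboolP[b cb]; apply/asboolP; exists b => s; apply: mulr4_inj.
rewrite [X in X *+ 4](_ : _ = iota_cochain c' s - iota_cochain c s); last first.
  by rewrite [LHS]ffunE [X in _ + X]ffunE.
rewrite mulrnBl -!iota_cochainE // mulrnBl -raddfMn -cb.
by rewrite (raddfB (W_act _)) !opprD addrACA.
Qed.

End Iota.

Definition H1_mod_torsion2 (G : {group W}) : zmodType :=
  Quotient.quot (torsion_sub (H1 G W_act) 2).

Definition iota_generates (G : {group W}) (c : Pic) : Prop :=
  exists cG : invariant4 G (\pi_Pic_mod4 c),
  let alpha := iota_Pic4 (exist _ (\pi_Pic_mod4 c) cG) in
  forall z : H1_mod_torsion2 G,
    exists k : int, z = \pi_(H1_mod_torsion2 G) alpha *~ k.

Definition i1 : 'I_5 := @Ordinal 5 0 isT.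
Definition i2 : 'I_5 := @Ordinal 5 1 isT.
Definition i3 : 'I_5 := @Ordinal 5 2 isT.
Definition i4 : 'I_5 := @Ordinal 5 3 isT.
Definition i5 : 'I_5 := @Ordinal 5 4 isT.

Definition tau_signs : 'rV['Z_2]_5 := \row_i (i != i5)%:R.

Definition tau : W := (W_perm (tperm i4 i5) * W_sign tau_signs)%g.

Lemma tau_signs_even : tau_signs \in even_signs.
Proof.
rewrite inE; apply/eqP; under eq_bigr do rewrite mxE.
by rewrite !big_ord_recr big_ord0 /=; apply/val_inj.
Qed.

Lemma W_act_tau_perm i : W_act tau (e_ i) =
  e_ (tperm i4 i5 i) *~ (-1) ^+ tau_signs 0 (tperm i4 i5 i).
Proof. by rewrite W_actM W_act_perm W_act_sign // tau_signs_even. Qed.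

Lemma W_act_tau i : W_act tau (e_ i) =
  if i == i4 then e_ i5 else if i == i5 then - e_ i4 else - e_ i.
Proof.
rewrite W_act_tau_perm mxE; case: tpermP => [->|->|/eqP/negPf-> /eqP i_5]//=.
by rewrite i_5 (negPf i_5).
Qed.

Definition S3 : {set W} := [set W_perm s | s in Sym [set i1; i2; i3]].

Lemma W_permM s t : W_perm (s * t) = (W_perm s * W_perm t)%g.
Proof. by rewrite /W_perm sdpair2_morphM ?inE. Qed.

Lemma S3_group_set : group_set S3.
Proof.
apply/group_setP; split.
  apply/imsetP; exists 1%g; first exact: group1.
  by rewrite /W_perm (morph1 (sdpair2_morphism _)).
move=> _ _ /imsetP[s ss ->] /imsetP[t ts ->].
by rewrite -W_permM imset_f // groupM.
Qed.

Canonical S3_group := Group S3_group_set.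

Lemma W_eqP (v w : W) : proj v = proj w -> sign v = sign w -> v = w.
Proof.
move=> pvw svw; apply: val_inj; move: pvw svw; rewrite /proj /sign /=.
by case: (\val v) (\val w) => [s a] [t b] /= -> ->.
Qed.

Lemma sign_tau : sign tau = tau_signs.
Proof.
apply/rowP => i; rewrite signM sign_W_perm (sign_W_sign tau_signs_even).
by rewrite mxE add0r.
Qed.

Lemma proj_tau : proj tau = tperm i4 i5.
Proof. by rewrite projM proj_W_perm proj_W_sign mulg1. Qed.

Lemma tau_exp4 : (tau ^+ 4 = 1)%g.
Proof.
have p2 : proj (tau ^+ 2)%g = 1%g.
  by rewrite expgS expg1 (projM tau) proj_tau tperm2.
rewrite (expgM _ 2 2) expgS expg1; apply: W_eqP.
  by rewrite projM p2 mulg1.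
apply/rowP => i; rewrite signM p2 invg1 perm1 [RHS]mxE.
by case: (sign _ 0 i) => [[|[|//]] ?]; apply: val_inj.
Qed.

(* remgr S3 <[tau]> is therefore the projection S3 x <[tau]> -> <[tau]>. *)
Lemma S3_tau_dprod : (S3 \x <[tau]> = S3 * <[tau]>)%g.
Proof.
apply: dprodE.
  rewrite centsC; apply/centsP => _ /imsetP[s ss ->] _ /cycleP[k ->].
  apply: commuteX.
  move: ss; rewrite inE => /subsetP ss.
  have s4 : s i4 = i4.
    by apply/eqP; apply: contraT => /ss; rewrite !inE.
  have s5 : s i5 = i5.
    by apply/eqP; apply: contraT => /ss; rewrite !inE.
  apply: W_eqP; last first.
    apply/rowP => i.
    rewrite (signM (W_perm s)) (signM tau) proj_W_perm sign_tau sign_W_perm.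
    rewrite !mxE.
    by rewrite add0r addr0 (canF_eq (permKV s)) s5.
  rewrite (projM tau) (projM (W_perm s)) proj_tau proj_W_perm.
  apply/permP => i; rewrite !permM.
  by rewrite (inj_tperm _ _ _ (@perm_inj _ s)) s4 s5.
apply/trivgP/subsetP => x /setIP[/imsetP[s ss ->] /cycleP[k sk]].
have s4 : s i4 = i4.
  apply/eqP; apply: contraT; move: ss; rewrite inE => /subsetP ss /ss.
  by rewrite !inE.
have t4 : W_act tau (e_ i4) = e_ i5 by rewrite W_act_tau.
have t5 : W_act tau (e_ i5) = - e_ i4 by rewrite W_act_tau.
have := W_act_perm s i4; rewrite s4 sk inE -(expg_mod k tau_exp4).
case: (k %% 4)%N (ltn_pmod k (isT : 0 < 4)%N) => [|[|[|[|//]]]] _.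
- by rewrite eqxx.
- by rewrite expg1 t4 => /(congr1 (fun c : Pic => c 0 i5)); rewrite !mxE.
- rewrite expgS expg1 W_actM t4 t5.
  by move=> /(congr1 (fun c : Pic => c 0 i4)); rewrite !mxE.
rewrite expgS W_actM t4 expgS expg1 W_actM t5 raddfN [X in - X]t4.
by move=> /(congr1 (fun c : Pic => c 0 i5)); rewrite !mxE.
Qed.

Definition normalised_typeI (G : {group W}) : Prop :=
  G \subset (S3 * <[tau]>)%g /\ (remgr S3 <[tau]> @: G)%g = <[tau]>%g.

Definition swaps_24_35 (s : 'S_5) : Prop :=
  s @: [set i2; i4] = [set i3; i5] /\ s @: [set i3; i5] = [set i2; i4].

Definition normalised_typeII (G : {group W}) : Prop :=
  [/\ forall w, w \in G ->
         proj w i1 = i1 /\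
         (proj w @: [set i2; i4] = [set i2; i4] \/
          proj w @: [set i2; i4] = [set i3; i5]),
      forall w, w \in G ->
         (swaps_24_35 (proj w) <-> W_act w (e_ i1) = - e_ i1)
    & exists2 w, w \in G & W_act w (e_ i1) = - e_ i1].

Definition typeI (G : {group W}) : Prop :=
  exists w : W, normalised_typeI (G :^ w)%G.

Definition typeII (G : {group W}) : Prop :=
  exists w : W, normalised_typeII (G :^ w)%G.

(* Main.v *)
(* Every class in H^1(G, Pic) is a quarter of the coboundary of an integral
   vector c, and then each w in G satisfies w c = c or w c = c + (2, .., 2)
   modulo 4. If w c = c for all w, then c is congruent modulo 2 to an invariant
   vector and the class is killed by 2. Otherwise some w swaps the sets
   {c_i = 0} and {c_i = 2}, so the number of odd c_i is odd, and it is not 5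
   because the product of the signs of w is 1. Hence it is 1 or 3, and c is
   conjugate to (1, 2, 0, 2, 0) (type II) or to (1, 1, 1, 2, 0) (type I).

   If c and d are two such vectors, then w adds (2, .., 2) to both or to none:
   otherwise w would add (2, .., 2) to c + d, which has an even number of odd
   entries. This makes c - d congruent modulo 2 to an invariant vector, so that
   H^1 modulo its 2-torsion has order 2. A class killed by 2 is half the
   coboundary of an integral b, whose set of odd entries is G-invariant and
   matters only up to complement; as w exchanges {c_i = 0} and {c_i = 2}, it is
   determined by its trace on the odd entries of c and on {c_i = 0}, which
   bounds the 2-torsion. *)

Require Import Defs.
From HB Require Import structures.
From mathcomp Require Import all_boot all_order all_fingroup all_algebra.
From mathcomp Require Import generic_quotient ring_quotient cyclic.
From mathcomp Require Import boolp zify ring.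

Set Implicit Arguments.
Unset Strict Implicit.
Unset Printing Implicit Defensive.

Import GRing.Theory Num.Theory.
Local Open Scope ring_scope.
Local Open Scope quotient_scope.

(** * Case analysis on small residues *)

Lemma Z2_ind (P : 'Z_2 -> Prop) : P 0 -> P 1 -> forall x, P x.
Proof.
move=> P0 P1 [m m2].
by case: m m2 => [|[|//]] m2; [move: P0 | move: P1]; congr P; apply/val_inj.
Qed.

Lemma Z4_ind (P : 'Z_4 -> Prop) : P 0 -> P 1 -> P 2 -> P 3 -> forall x, P x.
Proof.
move=> P0 P1 P2 P3 [m m4].
case: m m4 => [|[|[|[|//]]]] m4; [move: P0 | move: P1 | move: P2 | move: P3];
  by congr P; apply/val_inj.
Qed.

Lemma card_sum (T : finType) (A : {set T}) : #|A| = (\sum_i (i \in A))%N.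
Proof. by rewrite -sum1_card big_mkcond. Qed.

(** * The signed permutation action *)

(** The ring is a parameter because the same action is needed on rational vectors, where it is
    [W_actQ], on integral lifts and on residues modulo 4. *)
Definition sg (R : comNzRingType) (w : W) (i : 'I_5) : R := (-1) ^+ sign w 0 i.

Definition wact (R : comNzRingType) (w : W) (c : 'rV[R]_5) : 'rV[R]_5 :=
  \row_i (sg R w i * c 0 ((proj w)^-1%g i)).

Section SignedAction.

Variable R : comNzRingType.
Implicit Types (v w : W) (c d : 'rV[R]_5).

Lemma signZ2D (a b : 'Z_2) : (-1) ^+ (a + b)%R = (-1) ^+ a * (-1) ^+ b :> R.
Proof.
rewrite -exprD; elim/Z2_ind: a; elim/Z2_ind: b => //.
by rewrite [RHS]sqrrN [RHS]expr1n.
Qed.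

Lemma sgP w i : sg R w i = 1 \/ sg R w i = -1.
Proof.
rewrite /sg; elim/Z2_ind: (sign w 0 i).
by left; exact: expr0.
by right; exact: expr1.
Qed.

Lemma sgM v w i : sg R (v * w)%g i = sg R v ((proj w)^-1%g i) * sg R w i.
Proof.
rewrite /sg signM.
exact: signZ2D.
Qed.

Lemma sgMV v w i : sg R (v * w)%g (proj w i) = sg R v i * sg R w (proj w i).
Proof. by rewrite sgM permK. Qed.

Lemma sg1 i : sg R 1%g i = 1.
Proof. by rewrite /sg mxE expr0. Qed.

(** The sign vector of an element of [W] has sum 0, and x |-> (-1)^x turns sums in Z/2 into
    products. *)
Lemma prod_sg w : \prod_i sg R w i = 1.
Proof.
have : sign w \in even_signs by case: w => [[s a] sa]; have /setXP[] := sa.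
rewrite inE => /eqP e0.
have e1 : (-1) ^+ (0 : 'Z_2)%R = 1 :> R by exact: expr0.
by rewrite /sg -(big_morph (fun a : 'Z_2 => (-1) ^+ a : R) signZ2D e1) e0.
Qed.

Lemma wactE w c i : wact w c 0 (proj w i) = sg R w (proj w i) * c 0 i.
Proof. by rewrite mxE permK. Qed.

(** Indexing by [proj w i] removes the inverse permutation; [fixesP] and [flipsP] inherit this
    form. *)
Lemma wact_eq w c d :
  wact w c = d <-> forall i, sg R w (proj w i) * c 0 i = d 0 (proj w i).
Proof.
split=> [<- i|cd]; first by rewrite wactE.
by apply/rowP => i; rewrite -[i](permKV (proj w)) wactE cd.
Qed.

Lemma wactM v w c : wact (v * w)%g c = wact w (wact v c).
Proof.
apply/rowP => i; rewrite !mxE sgM projM invMg permM.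
by rewrite [sg R v _ * _]mulrC mulrA.
Qed.

Lemma wact1 c : wact 1%g c = c.
Proof. by apply/rowP => i; rewrite mxE sg1 mul1r invg1 perm1. Qed.

Lemma wactD w c d : wact w (c + d) = wact w c + wact w d.
Proof. by apply/rowP => i; rewrite !mxE mulrDr. Qed.

End SignedAction.

Lemma rmorph_sg (R S : comNzRingType) (f : {rmorphism R -> S}) w i :
  f (sg R w i) = sg S w i.
Proof. by rewrite /sg rmorph_sign. Qed.

Lemma map_wact (R S : comNzRingType) (f : {rmorphism R -> S}) w c :
  map_mx f (wact w c) = wact w (map_mx f c).
Proof. by apply/rowP => i; rewrite !mxE rmorphM rmorph_sg. Qed.

(** * Vectors modulo 4 fixed up to (2, .., 2) *)

Section Twisted.

Implicit Types (v w : W) (c d : 'rV['Z_4]_5) (G : {set W}).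

(** Four times the half-sum of the basis is (2, .., 2), so an integral vector whose class in
    [Pic_mod4] is invariant is fixed modulo 4 only up to this shift. [twisted] requires that the
    shift does occur. *)
Definition fixes w c := wact w c == c.
Definition flips w c := wact w c == c + const_mx 2.

Definition twisted G c :=
  [forall w in G, fixes w c || flips w c] && [exists w in G, flips w c].

Definition odds c := [set i | odd (c 0 i)].
Definition zeros c := [set i | c 0 i == 0].
Definition twos c := [set i | c 0 i == 2].

Lemma twistedP G c :
  reflect ((forall w, w \in G -> fixes w c \/ flips w c)
           /\ exists2 w, w \in G & flips w c) (twisted G c).
Proof.
apply: (iffP andP) => [[/forall_inP G1 /exists_inP[w wG cw]]|[G1 [w wG cw]]].
  by split=> [v /G1/orP//|]; exists w.
by split; [apply/forall_inP => v /G1/orP | apply/exists_inP; exists w].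
Qed.

Lemma fixesP w c :
  reflect (forall i, sg _ w (proj w i) * c 0 i = c 0 (proj w i)) (fixes w c).
Proof. by apply: (iffP eqP) => /wact_eq. Qed.

Lemma flipsP w c :
  reflect (forall i, sg _ w (proj w i) * c 0 i = c 0 (proj w i) + 2) (flips w c).
Proof.
by apply: (iffP eqP) => [/wact_eq h i|h]; [rewrite h !mxE | apply/wact_eq => i; rewrite h !mxE].
Qed.

Lemma wact_const2 w : wact w (const_mx 2) = const_mx 2 :> 'rV['Z_4]_5.
Proof.
apply/rowP => i; rewrite !mxE; case: (sgP 'Z_4 w i) => ->; rewrite ?mul1r//.
exact/val_inj.
Qed.

Lemma const22 : const_mx 2 + const_mx 2 = 0 :> 'rV['Z_4]_5.
Proof. by apply/rowP => i; rewrite !mxE; apply/val_inj. Qed.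

Lemma const2_neq0 : const_mx 2 != 0 :> 'rV['Z_4]_5.
Proof. by apply/eqP => /rowP/(_ 0); rewrite !mxE. Qed.

Lemma fixes_flips w c : fixes w c -> flips w c -> False.
Proof.
move=> /eqP e; rewrite /flips e -subr_eq0 opprD addNKr oppr_eq0.
by rewrite (negPf const2_neq0).
Qed.

(** The elements that fix or flip c are closed under products, and [flips] behaves there as the
    nontrivial value of a character to Z/2. *)
Lemma fixesM v w c : fixes v c -> fixes w c -> fixes (v * w)%g c.
Proof. by rewrite /fixes wactM => /eqP->. Qed.

Lemma fixes_flipsM v w c : fixes v c -> flips w c -> flips (v * w)%g c.
Proof. by rewrite /flips wactM => /eqP->. Qed.

Lemma flipsM v w c : flips v c -> flips w c -> fixes (v * w)%g c.
Proof.
rewrite /fixes wactM => /eqP-> /eqP e.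
by rewrite wactD e wact_const2 -addrA const22 addr0.
Qed.

Lemma fixes1 c : fixes 1%g c.
Proof. by rewrite /fixes wact1. Qed.

Lemma fixes_flipsD w c d : fixes w c -> flips w d -> flips w (c + d).
Proof. by rewrite /flips wactD => /eqP-> /eqP->; rewrite addrA. Qed.

(** Signs preserve parity and leave 0 and 2 unchanged, so on the three parts of the index set w acts
    by its permutation alone; the shift by 2 exchanges 0 with 2. *)
Lemma flips_odds w c i : flips w c -> (proj w i \in odds c) = (i \in odds c).
Proof.
move=> /flipsP/(_ i); rewrite !inE; case: (sgP 'Z_4 w (proj w i)) => ->.
all: by elim/Z4_ind: (c 0 i); elim/Z4_ind: (c 0 (proj w i)) => /(congr1 val).
Qed.

Lemma fixes_odds w c i : fixes w c -> (proj w i \in odds c) = (i \in odds c).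
Proof.
move=> /fixesP/(_ i); rewrite !inE; case: (sgP 'Z_4 w (proj w i)) => ->.
all: by elim/Z4_ind: (c 0 i); elim/Z4_ind: (c 0 (proj w i)) => /(congr1 val).
Qed.

Lemma flips_zeros w c i : flips w c -> (proj w i \in zeros c) = (i \in twos c).
Proof.
move=> /flipsP/(_ i); rewrite !inE; case: (sgP 'Z_4 w (proj w i)) => ->.
all: by elim/Z4_ind: (c 0 i); elim/Z4_ind: (c 0 (proj w i)) => /(congr1 val).
Qed.

Lemma flips_twos w c i : flips w c -> (proj w i \in twos c) = (i \in zeros c).
Proof.
move=> /flipsP/(_ i); rewrite !inE; case: (sgP 'Z_4 w (proj w i)) => ->.
all: by elim/Z4_ind: (c 0 i); elim/Z4_ind: (c 0 (proj w i)) => /(congr1 val).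
Qed.

Lemma fixes_zeros w c i : fixes w c -> (proj w i \in zeros c) = (i \in zeros c).
Proof.
move=> /fixesP/(_ i); rewrite !inE; case: (sgP 'Z_4 w (proj w i)) => ->.
all: by elim/Z4_ind: (c 0 i); elim/Z4_ind: (c 0 (proj w i)) => /(congr1 val).
Qed.

Lemma fixes_twos w c i : fixes w c -> (proj w i \in twos c) = (i \in twos c).
Proof.
move=> /fixesP/(_ i); rewrite !inE; case: (sgP 'Z_4 w (proj w i)) => ->.
all: by elim/Z4_ind: (c 0 i); elim/Z4_ind: (c 0 (proj w i)) => /(congr1 val).
Qed.

(** An odd residue modulo 4 is its own inverse, so the equation of [fixesP] can be solved for the
    sign. *)
Lemma fixes_sg w c i : fixes w c -> i \in odds c ->
  sg _ w (proj w i) = c 0 (proj w i) * c 0 i.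
Proof.
move=> /fixesP/(_ i) <-; rewrite inE -mulrA.
by elim/Z4_ind: (c 0 i) => // _; rewrite -[LHS]mulr1; congr (_ * _); apply/val_inj.
Qed.

(** For odd x one has x + 2 = -x modulo 4, so on odd entries a flip is a change of sign. *)
Lemma flips_sg w c i : flips w c -> i \in odds c ->
  sg _ w (proj w i) = - (c 0 (proj w i) * c 0 i).
Proof.
move=> cw ic; have := ic; rewrite -(flips_odds _ cw).
move: ic cw; rewrite !inE => + /flipsP/(_ i).
case: (sgP 'Z_4 w (proj w i)) => ->;
  elim/Z4_ind: (c 0 i) => //; elim/Z4_ind: (c 0 (proj w i)) => //;
  by move=> _ /(congr1 val)// _ _; apply/val_inj.
Qed.

Lemma card_parts c : (#|odds c| + #|zeros c| + #|twos c| = 5)%N.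
Proof.
rewrite !card_sum -!big_split /= -[RHS]card_ord -sum1_card.
apply: eq_bigr => i _; rewrite !inE.
by elim/Z4_ind: (c 0 i).
Qed.

Lemma flips_card w c : flips w c -> #|zeros c| = #|twos c|.
Proof.
move=> cw; rewrite -(card_imset (twos c) (@perm_inj _ (proj w))).
apply: eq_card => i; rewrite -[i](permKV (proj w)) flips_zeros //.
by rewrite mem_imset //; apply: perm_inj.
Qed.

(** By [flips_sg] each factor is minus a product of two odd entries. As w permutes the odd indices,
    every entry occurs twice, and odd squares are 1. *)
Lemma flips_prod_sg w c : flips w c ->
  \prod_(i in odds c) sg 'Z_4 w i = (-1) ^+ #|odds c|.
Proof.
move=> cw.
have E (F : 'I_5 -> 'Z_4) :
    \prod_(i in odds c) F i = \prod_(i in odds c) F (proj w i).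
  rewrite (reindex_inj (@perm_inj _ (proj w))) /=.
  by apply: eq_bigl => i; rewrite flips_odds.
rewrite E (eq_bigr _ (fun i => @flips_sg w c i cw)).
rewrite prodrN big_split /= -(E (fun i => c 0 i)) -big_split /=.
rewrite big1 ?mulr1 // => i; rewrite inE.
by elim/Z4_ind: (c 0 i) => // _; apply/val_inj.
Qed.

Lemma flips_odds_card w c : flips w c -> #|odds c| = 1%N \/ #|odds c| = 3%N.
Proof.
move=> cw; have := card_parts c; rewrite (flips_card cw).
case: (#|twos c|) => [|[|[|n]]]; try lia.
rewrite !addn0 => c5; have := flips_prod_sg cw; rewrite c5.
have -> : odds c = setT by apply/eqP; rewrite eqEcard subsetT cardsT card_ord c5.
by under eq_bigl do rewrite inE; rewrite prod_sg => /(congr1 val).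
Qed.

Lemma flips_odds_odd w c : flips w c -> odd #|odds c|.
Proof. by move=> /flips_odds_card[] ->. Qed.

(** The sum d + c is flipped as well, so both c and d + c have an odd number of odd entries, and
    this number is additive modulo 2. *)
Lemma flips_fixes_odd w c d : flips w c -> fixes w d -> ~~ odd #|odds d|.
Proof.
move=> cw dw; apply/negP => d1.
have := flips_odds_odd (fixes_flipsD dw cw).
have -> : odd #|odds (d + c)| = odd #|odds d| (+) odd #|odds c|.
  rewrite !card_sum !(big_morph _ oddD (erefl _)) -big_split.
  apply: eq_bigr => i _ /=; rewrite !inE mxE.
  by elim/Z4_ind: (c 0 i); elim/Z4_ind: (d 0 i).
by rewrite d1 (flips_odds_odd cw).
Qed.

Lemma twisted_flips G c d w : twisted G c -> twisted G d -> w \in G ->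
  flips w c -> flips w d.
Proof.
move=> /twistedP[cG _] /twistedP[dG [v vG dv]] wG cw.
case: (dG w wG) => // dw.
by have := flips_fixes_odd cw dw; rewrite (flips_odds_odd dv).
Qed.

End Twisted.

(** * Classes divided from coboundaries *)

(** The remainder is a natural number below 4, so that one case analysis settles an integer and its
    residue together. *)
Lemma Z4_int (x : int) :
  exists q (r : nat), [/\ (r < 4)%N, x = q * 4 + r%:Z & x%:~R = r%:R :> 'Z_4].
Proof.
have r4 : (`|(x %% 4)%Z|%N < 4)%N by lia.
exists (x %/ 4)%Z, `|(x %% 4)%Z|%N; split=> //; first by lia.
have {1}-> : x = (x %/ 4)%Z * 4 + `|(x %% 4)%Z|%N%:Z by lia.
rewrite rmorphD rmorphM /= [X in _ * X](_ : _ = 0) ?mulr0 ?add0r //.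
exact/val_inj.
Qed.

Definition bar (c : 'rV[int]_5) : 'rV['Z_4]_5 := \row_i (c 0 i)%:~R.

Lemma bar_wact w (c : 'rV[int]_5) : bar (wact w c) = wact w (bar c).
Proof. by apply/rowP => i; rewrite !mxE rmorphM rmorph_sg. Qed.

Lemma barB (c d : 'rV[int]_5) : bar (c - d) = bar c - bar d.
Proof. by apply/rowP => i; rewrite !mxE rmorphB. Qed.

Lemma intr_in_lattice (c : 'rV[int]_5) : map_mx intr c \in lattice.
Proof. by apply/asboolP; exists c, 0; rewrite mulr0z addr0. Qed.

Definition emb (c : 'rV[int]_5) : Pic := MkPic (intr_in_lattice c).

Lemma emb_is_zmod_morphism : zmod_morphism emb.
Proof. by move=> c d; apply: val_inj; rewrite /= raddfB. Qed.

HB.instance Definition _ :=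
  GRing.isZmodMorphism.Build 'rV[int]_5 Pic emb emb_is_zmod_morphism.

Lemma W_act_emb w c : W_act w (emb c) = emb (wact w c).
Proof. by apply: val_inj; rewrite /= map_wact. Qed.

Lemma PicP (b : Pic) : exists (u : 'rV[int]_5) (k : int),
  forall i, val b 0 i = (u 0 i)%:~R + k%:~R / 2%:R.
Proof.
have /asboolP[u [k bE]] := valP b; exists u, k => i.
rewrite bE -scaler_int !mxE summxE (bigD1 i) //= big1 => [|j ji].
  by rewrite mxE !eqxx addr0 mulr1.
by rewrite mxE eq_sym (negPf ji) andbF.
Qed.

Lemma Pic_half (u : 'rV[int]_5) (k : int) :
  exists b : Pic, forall i, val b 0 i = (u 0 i)%:~R + k%:~R / 2%:R.
Proof.
have bL : map_mx intr u + (2%:R^-1 *: \sum_i delta_mx 0 i) *~ k \in lattice.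
  by apply/asboolP; exists u, k.
exists (MkPic bL) => i /=; rewrite -scaler_int !mxE summxE (bigD1 i) //=.
rewrite big1 => [|j ji]; first by rewrite mxE !eqxx addr0 mulr1.
by rewrite mxE eq_sym (negPf ji) andbF.
Qed.

Lemma Pic_mulr2_inj (b c : Pic) : b *+ 2 = c *+ 2 -> b = c.
Proof. by move=> bc; apply: mulr4_inj; rewrite /= !(mulrnA _ 2 2) bc. Qed.

(** All coordinates of b share the half-integral part k/2, so those of 4 b are 2 k modulo 4, and
    only the parity of k matters. *)
Lemma mult4_bar (c : 'rV[int]_5) (b : Pic) : emb c = b *+ 4 ->
  bar c = 0 \/ bar c = const_mx 2.
Proof.
have [u [k bE]] := PicP b => /(congr1 val)/rowP cb.
have cE i : c 0 i = u 0 i * 4 + k * 2.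
  apply: (@intr_inj rat); have := cb i.
  rewrite raddfMn mulmxnE bE mxE => ->; rewrite rmorphD !rmorphM /=.
  by field.
have [q [r [r4 kE kr]]] := Z4_int k.
have E i : (c 0 i)%:~R = r%:R * 2 :> 'Z_4.
  rewrite cE rmorphD !rmorphM /= kr [X in _ * X + _](_ : _ = 0) ?mulr0 ?add0r //.
  exact/val_inj.
case: r r4 {kE kr} E => [|[|[|[|//]]]] _ E; [left|right|left|right];
  by apply/rowP => i; rewrite !mxE E; apply/val_inj.
Qed.

Lemma bar_mult4 (c : 'rV[int]_5) : bar c = 0 \/ bar c = const_mx 2 ->
  exists b : Pic, emb c = b *+ 4.
Proof.
(* Here k/2 is the common half-integral part of b: k = 0 for residues 0 and k = 1 for residues 2. *)
have main (k : nat) : (k < 2)%N -> (forall i, (c 0 i)%:~R = (k * 2)%:R :> 'Z_4) ->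
    exists b : Pic, emb c = b *+ 4.
  move=> k2 ck; have [b bE] := Pic_half (\row_i (c 0%R i %/ 4)%Z) k.
  exists b; apply/val_inj/rowP => i; rewrite raddfMn mulmxnE bE !mxE.
  have cE : c 0 i = (c 0%R i %/ 4)%Z * 4 + k%:Z * 2.
    have [q [r [r4 cE cr]]] := Z4_int (c 0 i).
    move: (ck i); rewrite cr => /(congr1 val) /=.
    by case: k k2 {bE ck} => [|[|//]] _; case: r r4 cE {cr} => [|[|[|[|//]]]] _ cE //; lia.
  by rewrite {1}cE rmorphD !rmorphM /=; field.
case=> /rowP cE; [apply: (main 0%N) | apply: (main 1%N)] => // i;
  by have := cE i; rewrite !mxE.
Qed.

Section Classes.

Variable G : {group W}.
Notation H := (H1 G W_act).
Implicit Types (b m : Pic) (c d : 'rV[int]_5) (x y z : H).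

(* [z] is 1/n of the coboundary of [b]. *)
Definition divided_coboundary n b z : Prop :=
  exists2 f : Z1 G W_act, z = \pi_H f &
    forall s, f s *+ n = W_act (sgval s) b - b.

Definition represents c z := divided_coboundary 4 (emb c) z.

Lemma divided_coboundaryB n b b' z z' :
  divided_coboundary n b z -> divided_coboundary n b' z' ->
  divided_coboundary n (b - b') (z - z').
Proof.
move=> [f -> fE] [f' -> f'E]; exists (f - f'); first by rewrite raddfB.
move=> s; have -> : (f - f') s = f s - f' s by rewrite [LHS]ffunE [X in _ + X]ffunE.
by rewrite mulrnBl fE f'E (raddfB (W_act _)) !opprD addrACA.
Qed.

Lemma coboundary_eq0 (f : Z1 G W_act) b :
  (forall s, f s = W_act (sgval s) b - b) -> \pi_H f = 0.
Proof.
move=> fE; apply/eqP; rewrite -[0](raddf0 \pi_H) -Quotient.idealrBE subr0.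
by apply/asboolP; exists b.
Qed.

Lemma divided_coboundary_eq0 b z :
  divided_coboundary 2 (b *+ 2) z -> z = 0.
Proof.
move=> [f -> fE]; apply: (@coboundary_eq0 _ b) => s.
by apply: Pic_mulr2_inj; rewrite fE raddfMn mulrnBl.
Qed.

(** As m is invariant, 4 f is the coboundary of 2 b; the lattice is torsion-free, so 2 f is the
    coboundary of b. *)
Lemma represents_torsion c m b z :
  represents c z -> (forall w, w \in G -> W_act w m = m) -> emb c = m + b *+ 2 ->
  z *+ 2 = 0.
Proof.
move=> [f -> fE] mG cE; rewrite -raddfMn; apply: (@coboundary_eq0 _ b) => s.
have -> : (f *+ 2) s = f s *+ 2 by rewrite !mulr2n [LHS]ffunE.
have mE : W_act (sgval s) m = m by exact: mG (valP s).
apply: Pic_mulr2_inj; rewrite -mulrnA fE cE raddfD /= mE raddfMn.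
by rewrite opprD addrACA subrr add0r mulrnBl.
Qed.

Lemma torsion_divided c z : represents c z -> z *+ 2 = 0 ->
  exists b, divided_coboundary 2 b z.
Proof.
move=> [f -> fE]; rewrite -raddfMn => f2.
have /eqP : \pi_H (f *+ 2) = \pi_H 0 by rewrite f2 raddf0.
rewrite -Quotient.idealrBE subr0 => /asboolP[b bE].
exists b, f => // s; rewrite -bE.
by rewrite !mulr2n [RHS]ffunE.
Qed.

Lemma divided_represents b d z :
  divided_coboundary 2 b z -> b *+ 2 = emb d -> represents d z.
Proof.
move=> [f zE fE] bd; exists f => // s.
by rewrite (mulrnA _ 2 2) fE -bd raddfMn mulrnBl.
Qed.

Lemma represents_bar c z w : represents c z -> w \in G ->
  fixes w (bar c) \/ flips w (bar c).
Proof.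
move=> [f _ fE] wG; have := fE (subg G w); rewrite subgK // W_act_emb -raddfB.
move=> /esym/mult4_bar; rewrite barB bar_wact /fixes /flips.
by case=> /eqP; rewrite subr_eq; [rewrite add0r; left | rewrite addrC; right].
Qed.

(** Averaging over G writes f as the coboundary of a rational vector u/2. Subtracting a suitable
    invariant vector from u/2 leaves a quarter of an integral vector. *)
Lemma represents_exists z : exists c, represents c z.
Proof.
set f : Z1 G W_act := repr z.
have fM s t : f (t * s)%g = f s + W_act (sgval s) (f t).
  by have /'forall_'forall_eqP := valP f; apply.
pose F : Pic := \sum_s f s.
pose n : rat := #|{: subg_of G}|%:R.
have n0 : n != 0 by rewrite pnatr_eq0 -lt0n; apply/card_gt0P; exists 1%g.
(* The cocycle identity is summed over t. *)
have FE s : f s *+ #|{: subg_of G}| = F - W_act (sgval s) F.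
  rewrite {1}/F (reindex_inj (mulIg s)) /=; under eq_bigr do rewrite fM.
  by rewrite big_split /= sumr_const -raddf_sum /= addrK.
(* By [FE], f is the coboundary of -F/n; the factor 2 makes the coboundary of u integral. *)
pose u : 'rV[rat]_5 := \row_i (- (2 * val F 0 i / n)).
have uF i : u 0 i = - (2 * val F 0 i / n) by rewrite mxE.
clearbody u.
pose rnd (x : rat) : int := Num.floor x - Num.floor (- x).
(* x - rnd x / 2 is an odd, 1-periodic function of x, so that it turns u,
   which is G-invariant up to signs modulo 1, into an honestly invariant vector. *)
have rndN (x : rat) : rnd (- x) = - rnd x by rewrite /rnd opprK opprB.
have rndD (x : rat) (k : int) : rnd (x + k%:~R) = rnd x + k * 2.
  rewrite /rnd opprD -[- k%:~R]rmorphN /= !floorDrz ?rpred_int // !intrKfloor.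
  by ring.
have rndM w i (x : rat) : rnd (sg _ w i * x) = sg _ w i * rnd x.
  rewrite /sg; elim/Z2_ind: (sign w 0 i).
    by rewrite [X in X * x]expr0 [X in _ = X * _]expr0 !mul1r.
  by rewrite [X in X * x]expr1 [X in _ = X * _]expr1 !mulN1r.
exists (\row_i rnd (u 0 i)), f; first by rewrite reprK.
move=> s; apply/val_inj/rowP => i.
have [v [k fE]] := PicP (f s).
rewrite raddfMn mulmxnE W_act_emb raddfB !mxE fE.
(* This integer is twice the i-th coordinate of [f s]. *)
pose l := v 0 i * 2 + k.
have uE : sg _ (sgval s) i * u 0 ((proj (sgval s))^-1%g i) = u 0 i + l%:~R.
  have : val (f s *+ #|{: subg_of G}|) 0 i = val (F - W_act (sgval s) F) 0 i.
    by rewrite FE.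
  rewrite raddfMn mulmxnE fE.
  rewrite /l !uF !mxE -/(sg rat _ _) rmorphD rmorphM /=.
  set g := sg _ _ _; set x := row_of_Pic F _ _; set y := row_of_Pic F _ _.
  rewrite -mulr_natl -/n => E.
  have -> : (v 0 i)%:~R * 2 + k%:~R = (2 * (x - g * y)) / n.
    by rewrite -E; field.
  by field.
rewrite -rndM uE rndD /l !rmorphD !rmorphM rmorphD rmorphM /=.
by field.
Qed.

End Classes.

(** An integral lift modulo 2 that is an odd function, and hence commutes with signs: entrywise it
    makes a vector fixed modulo 4 into an invariant integral vector of the same parity. *)
Definition psi (x : 'Z_4) : int := if x == 1 then 1 else if x == 3 then -1 else 0.

(* The parity of link x y is that of x - y; moreover link is odd in (x, y) and
   invariant under (x, y) |-> (x + 2, y + 2), so that, applied entrywise to two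
   twisted vectors, it gives an invariant one. *)
Definition link (x y : 'Z_4) : int := psi x * psi (1 - y) + psi y * psi (1 - x).

(** Two arguments serve [link]; [psi] is covered by a function that ignores the second one. *)
Lemma odd_sg (h : 'Z_4 -> 'Z_4 -> int) w i x y :
  (forall x y, h (- x) (- y) = - h x y) ->
  h (sg _ w i * x) (sg _ w i * y) = sg _ w i * h x y.
Proof.
move=> hN; rewrite /sg; elim/Z2_ind: (sign w 0 i).
  by rewrite [X in X * x]expr0 [X in _ = X * _]expr0 !mul1r.
by rewrite [X in X * x]expr1 [X in _ = X * _]expr1 !mulN1r.
Qed.

Lemma psiN x : psi (- x) = - psi x.
Proof. by elim/Z4_ind: x. Qed.

Lemma linkN x y : link (- x) (- y) = - link x y.
Proof. by elim/Z4_ind: x; elim/Z4_ind: y. Qed.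

Lemma link_add2 x y : link (x + 2) (y + 2) = link x y.
Proof. by elim/Z4_ind: x; elim/Z4_ind: y. Qed.

Lemma psi_parity (x : int) : exists q, x = psi x%:~R + q * 2.
Proof.
have [q [r [r4 xE ->]]] := Z4_int x.
case: r r4 xE => [|[|[|[|//]]]] _ ->.
- by exists (q * 2); rewrite (_ : psi _ = 0) //; ring.
- by exists (q * 2); rewrite (_ : psi _ = 1) //; ring.
- by exists (q * 2 + 1); rewrite (_ : psi _ = 0) //; ring.
- by exists (q * 2 + 2); rewrite (_ : psi _ = -1) //; ring.
Qed.

Lemma link_parity (x y : int) : exists q, x - y = link x%:~R y%:~R + q * 2.
Proof.
have [q [r [r4 -> ->]]] := Z4_int x; have [q' [r' [r'4 -> ->]]] := Z4_int y.
suff [l lE] : exists l, r%:Z - r'%:Z = link r%:R r'%:R + l * 2.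
  by exists (q * 2 - q' * 2 + l); rewrite mulrDl addrCA -lE; ring.
case: r r4 => [|[|[|[|//]]]] _; case: r' r'4 => [|[|[|[|//]]]] _;
  first [by exists 0 | by exists 1 | by exists (-1) | by exists 2 | by exists (-2)].
Qed.

Lemma emb_parity (c m : 'rV[int]_5) :
  (forall i, exists q, c 0 i = m 0 i + q * 2) -> exists b, emb c = emb m + b *+ 2.
Proof.
move=> cm; exists (emb (\row_i ((c 0%R i - m 0%R i) %/ 2)%Z)).
rewrite -raddfMn -raddfD; congr emb; apply/rowP => i.
have [q cE] := cm i; rewrite mxE [X in _ + X]mulmxnE mxE.
by rewrite cE [X in (X %/ _)%Z]addrC addKr mulzK // mulr_natr.
Qed.

(** * Fixed vectors against twisted vectors *)

Section Dichotomy.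

Variable G : {group W}.
Notation H := (H1 G W_act).
Implicit Types (c d : 'rV[int]_5) (x y z : H).

(** The entrywise [psi] of c is an invariant vector congruent to c modulo 2, so [represents_torsion]
    applies. *)
Lemma fixed_torsion c z : represents c z ->
  (forall w, w \in G -> fixes w (bar c)) -> z *+ 2 = 0.
Proof.
move=> cz cG; pose m := \row_i psi (bar c 0 i).
have [i|b cE] := @emb_parity c m.
  by have [q qE] := psi_parity (c 0 i); exists q; rewrite !mxE.
apply: (represents_torsion cz _ cE) => w /cG/fixesP cw.
rewrite W_act_emb; congr emb; apply/wact_eq => i.
rewrite !mxE -(odd_sg (h := fun a _ => psi a) _ _ _ 0) => [|a _]; last exact: psiN.
by have := cw i; rewrite !mxE => ->.
Qed.

Lemma represents_twisted c z : represents c z -> z *+ 2 <> 0 -> twisted G (bar c).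
Proof.
move=> cz z2; apply/negPn/negP => tG; case: z2; apply: (fixed_torsion cz) => w wG.
 case: (represents_bar cz wG) => // cw; case/negP: tG; apply/twistedP.
by split=> [v vG|]; [exact: represents_bar cz vG | exists w].
Qed.

(** By [twisted_flips] each w fixes both residue vectors or flips both. In either case their
    entrywise [link] is preserved, and it is congruent to c - c' modulo 2. *)
Lemma twisted_torsion c c' z z' : represents c z -> represents c' z' ->
  twisted G (bar c) -> twisted G (bar c') -> (z - z') *+ 2 = 0.
Proof.
move=> cz c'z' cG c'G; pose m := \row_i link (bar c 0 i) (bar c' 0 i).
have [i|b cE] := @emb_parity (c - c') m.
  by have [q qE] := link_parity (c 0 i) (c' 0 i); exists q; rewrite !mxE.
have cz' : represents (c - c') (z - z').
  by rewrite /represents raddfB; apply: divided_coboundaryB.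
apply: (represents_torsion cz' _ cE) => w wG.
rewrite W_act_emb; congr emb; apply/wact_eq => i.
rewrite [m 0 i]mxE [m 0 _]mxE -odd_sg; last exact: linkN.
have /twistedP[/(_ w wG)[] cw _] := cG.
  have /twistedP[/(_ w wG)[c'w|c'w] _] := c'G.
    by congr link; apply/fixesP.
  by case: (fixes_flips cw); apply: twisted_flips c'G cG wG c'w.
have c'w := twisted_flips cG c'G wG cw.
by rewrite -[RHS]link_add2; congr link; apply/flipsP.
Qed.

End Dichotomy.

(** * The two types of subgroups *)

Lemma I5_ind (P : 'I_5 -> Prop) :
  P i1 -> P i2 -> P i3 -> P i4 -> P i5 -> forall i, P i.
Proof.
move=> P1 P2 P3 P4 P5 [m m5].
case: m m5 => [|[|[|[|[|//]]]]] m5;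
  [move: P1 | move: P2 | move: P3 | move: P4 | move: P5]; by congr P; apply/val_inj.
Qed.

Lemma W_exists (p : 'S_5) (a : 'rV['Z_2]_5) : a \in even_signs ->
  exists w : W, proj w = p /\ sign w = a.
Proof.
move=> ea; exists (W_perm p * W_sign a)%g; split.
  by rewrite projM proj_W_perm proj_W_sign mulg1.
apply/rowP => i; rewrite signM sign_W_perm (sign_W_sign ea).
by rewrite mxE add0r.
Qed.

Lemma sg_sign0 w i : sg 'Z_4 w i = 1 -> sign w 0 i = 0.
Proof. by rewrite /sg; elim/Z2_ind: (sign w 0 i) => // /(congr1 val). Qed.

Lemma sg_inj w i v j : sg 'Z_4 w i = sg 'Z_4 v j -> sign w 0 i = sign v 0 j.
Proof.
rewrite /sg; elim/Z2_ind: (sign w 0 i); elim/Z2_ind: (sign v 0 j) => //;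
  by move=> /(congr1 val).
Qed.

(** A code for the orbit of x under sign change: 1 and 3 are identified. *)
Definition residue_class (x : 'Z_4) : nat := if odd x then 1%N else x.

Lemma wact_transitive (c d : 'rV['Z_4]_5) :
  #|odds c| = #|odds d| -> #|zeros c| = #|zeros d| -> (#|odds d| < 5)%N ->
  exists w, wact w c = d.
Proof.
move=> cd1 cd0 d5.
have cd2 : #|twos c| = #|twos d|.
  by have := card_parts c; have := card_parts d; lia.
pose cl (b : 'rV['Z_4]_5) := [tuple residue_class (b 0 i) | i < 5].
have clE (b : 'rV['Z_4]_5) (A : {set 'I_5}) m :
    (forall i, (i \in A) = (residue_class (b 0 i) == m)) ->
    count_mem m (cl b) = #|A|.
  move=> bA; rewrite /cl count_map cardE /enum_mem size_filter -enumT.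
  by apply: eq_count => i /=; rewrite bA.
have [p pE] : exists p : 'S_5, cl c = [tuple tnth (cl d) (p i) | i < 5] :> seq nat.
  apply/tuple_permP/allP => m _; apply/eqP.
  have cl0 (b : 'rV['Z_4]_5) i : (i \in zeros b) = (residue_class (b 0 i) == 0%N).
    by rewrite inE /residue_class; elim/Z4_ind: (b 0 i).
  have cl1 (b : 'rV['Z_4]_5) i : (i \in odds b) = (residue_class (b 0 i) == 1%N).
    by rewrite inE /residue_class; elim/Z4_ind: (b 0 i).
  have cl2 (b : 'rV['Z_4]_5) i : (i \in twos b) = (residue_class (b 0 i) == 2%N).
    by rewrite inE /residue_class; elim/Z4_ind: (b 0 i).
  case: m => [|[|[|m]]].
  - by rewrite /= !(clE _ _ _ (cl0 _)) cd0.
  - by rewrite /= !(clE _ _ _ (cl1 _)) cd1.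
  - by rewrite /= !(clE _ _ _ (cl2 _)) cd2.
  have cl3 (b : 'rV['Z_4]_5) i : (i \in set0) = (residue_class (b 0 i) == m.+3).
    by rewrite inE /residue_class; elim/Z4_ind: (b 0 i).
  by rewrite /= !(clE _ _ _ (cl3 _)).
have {}pE i : residue_class (c 0 i) = residue_class (d 0 (p i)).
  have /(congr1 (fun s => nth 0%N s i)) := pE.
  by rewrite -!tnth_nth !tnth_mktuple.
have [j0 j0d] : exists j, j \notin odds d.
  apply/existsP; rewrite -negb_forall; apply/negP => /forallP dT.
  by move: d5; rewrite (eq_card (B := predT)) ?card_ord.
pose b j : 'Z_2 := ((j \in odds d) && (c 0 (p^-1%g j) != d 0 j))%:R.
(* The total of the corrections is added at [j0], which makes the sum of [a] even. *)
pose a : 'rV['Z_2]_5 := \row_j (b j + (j == j0)%:R * \sum_i b i).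
have ea : a \in even_signs.
  rewrite inE; apply/eqP; under eq_bigr do rewrite mxE.
  have j01 : \sum_i (i == j0)%:R = 1 :> 'Z_2.
    by rewrite (bigD1 j0) //= eqxx big1 ?addr0 // => i /negPf->.
  rewrite big_split /= -mulr_suml j01 mul1r.
  by elim/Z2_ind: (\sum_i b i); apply/val_inj.
have [w [wp wa]] := W_exists p ea.
exists w; apply/wact_eq => i; rewrite wp /sg wa mxE.
have [jd|] := boolP (p i \in odds d).
  have [ji|_] := eqVneq (p i) j0; first by rewrite -ji jd in j0d.
  rewrite mul0r addr0 /b jd permK /=; move: jd (pE i).
  rewrite inE /residue_class.
  by elim/Z4_ind: (d 0 (p i)) => //; elim/Z4_ind: (c 0 i) => // _ _; apply/val_inj.
move: (pE i); rewrite inE /residue_class; elim/Z2_ind: (_ + _).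
  by elim/Z4_ind: (d 0 (p i)) => //; elim/Z4_ind: (c 0 i) => // _ _; apply/val_inj.
by elim/Z4_ind: (d 0 (p i)) => //; elim/Z4_ind: (c 0 i) => // _ _; apply/val_inj.
Qed.

Lemma card_odds_wact w c : #|odds (wact w c)| = #|odds c|.
Proof.
rewrite -(card_imset (odds c) (@perm_inj _ (proj w))); apply: eq_card => i.
rewrite -[i](permKV (proj w)) mem_imset; last exact: perm_inj.
rewrite !inE wactE; case: (sgP 'Z_4 w (proj w ((proj w)^-1%g i))) => ->.
  by rewrite mul1r.
by elim/Z4_ind: (c 0 _).
Qed.

Lemma twisted_conj (A : {set W}) c w :
  twisted A c -> twisted (A :^ w)%g (wact w c).
Proof.
have conjE v : wact (v ^ w)%g (wact w c) = wact w (wact v c).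
  by rewrite /conjg !wactM -[wact w^-1%g _]wactM mulgV wact1.
move=> /twistedP[cA [u uA cu]]; apply/twistedP; split=> [_ /imsetP[v vA ->]|].
  rewrite /fixes /flips conjE; case: (cA v vA) => /eqP->; first by left.
  by right; rewrite wactD wact_const2.
exists (u ^ w)%g; first by rewrite memJ_conjg.
by rewrite /flips conjE (eqP cu) wactD wact_const2.
Qed.

(** [c_I] and [c_II] are the residues modulo 4 of the two vectors in the theorem. The normalised
    subgroups of each type turn out to be those twisted by the respective vector. *)
Definition c_I : 'rV['Z_4]_5 := \row_i nth 0 [:: 1; 1; 1; 2; 0] i.
Definition c_II : 'rV['Z_4]_5 := \row_i nth 0 [:: 1; 2; 0; 2; 0] i.

Lemma c_I_parts :
  [/\ odds c_I = [set i1; i2; i3], zeros c_I = [set i5] & twos c_I = [set i4]].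
Proof. by split; apply/setP; elim/I5_ind; rewrite !inE !mxE. Qed.

Lemma c_II_parts :
  [/\ odds c_II = [set i1], zeros c_II = [set i3; i5] & twos c_II = [set i2; i4]].
Proof. by split; apply/setP; elim/I5_ind; rewrite !inE !mxE. Qed.

Lemma card_odds_c_I : #|odds c_I| = 3%N.
Proof. by case: c_I_parts => -> _ _; rewrite -setUA cardsU1 cards2 !inE. Qed.

Lemma card_odds_c_II : #|odds c_II| = 1%N.
Proof. by case: c_II_parts => -> _ _; rewrite cards1. Qed.

Lemma flips_tau : flips tau c_I.
Proof.
apply/flipsP => i; rewrite proj_tau /sg sign_tau !mxE.
by elim/I5_ind: i; rewrite !permE; apply/eqP.
Qed.

Lemma tau_expg k : if odd k then flips (tau ^+ k)%g c_I else fixes (tau ^+ k)%g c_I.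
Proof.
elim: k => [|k IHk]; first exact: fixes1.
rewrite oddS expgSr; case: (odd k) IHk => h /=.
  exact: flipsM h flips_tau.
exact: fixes_flipsM h flips_tau.
Qed.

Lemma fix45_Sym (s : 'S_5) : (s \in Sym [set i1; i2; i3]) = (s i4 == i4) && (s i5 == i5).
Proof.
rewrite inE; apply/subsetP/andP => [sS|[/eqP s4 /eqP s5] i].
  by split; apply: contraT => /sS; rewrite !inE.
by elim/I5_ind: i; rewrite !inE // ?s4 ?s5 eqxx.
Qed.

Lemma c_I_odds i : i \in odds c_I -> c_I 0 i = 1.
Proof. by rewrite inE mxE; elim/I5_ind: i. Qed.

Lemma prod_I5 (F : 'I_5 -> 'Z_4) : \prod_i F i = F i1 * F i2 * F i3 * F i4 * F i5.
Proof.
rewrite !big_ord_recl big_ord0 mulr1 !mulrA.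
by do !congr (_ * _); congr F; apply/val_inj.
Qed.

Lemma S3_fixes x : x \in S3 -> fixes x c_I.
Proof.
move=> /imsetP[s]; rewrite fix45_Sym => /andP[/eqP s4 /eqP s5 ->].
apply/fixesP => i; rewrite proj_W_perm /sg sign_W_perm.
rewrite [X in X * _](_ : _ = 1); last by rewrite mxE; exact: expr0.
rewrite mul1r; have [-> | i4'] := eqVneq i i4; first by rewrite s4.
have [-> | i5'] := eqVneq i i5; first by rewrite s5.
have s4' : s i != i4 by rewrite -s4 (inj_eq perm_inj).
have s5' : s i != i5 by rewrite -s5 (inj_eq perm_inj).
have c1 j : j != i4 -> j != i5 -> c_I 0 j = 1.
  by rewrite mxE; elim/I5_ind: j; rewrite ?eqxx.
by rewrite !c1.
Qed.

(** Such a w fixes the indices [i4] and [i5] and has sign 1 at the other three; evenness then makes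
    the signs at [i4] and [i5] agree. *)
Lemma fixes_c_I w : fixes w c_I ->
  exists2 x, x \in S3 & exists2 k, ~~ odd k & w = (x * tau ^+ k)%g.
Proof.
have [oI zI tI] := c_I_parts => wI.
have w4 : proj w i4 = i4.
  by apply/set1P; rewrite -tI fixes_twos // tI set11.
have w5 : proj w i5 = i5.
  by apply/set1P; rewrite -zI fixes_zeros // zI set11.
have xS : W_perm (proj w) \in S3 by rewrite imset_f // fix45_Sym w4 w5 !eqxx.
have w1 i : i \in odds c_I -> sg 'Z_4 w i = 1.
  rewrite -[i](permKV (proj w)) fixes_odds // => ic.
  by rewrite (fixes_sg wI ic) !c_I_odds ?fixes_odds // mulr1.
have w45 : sg 'Z_4 w i4 = sg 'Z_4 w i5.
  have := prod_sg 'Z_4 w; rewrite prod_I5 (w1 i1) ?(w1 i2) ?(w1 i3) ?oI ?inE // !mul1r.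
  by case: (sgP 'Z_4 w i4) => ->; case: (sgP 'Z_4 w i5) => -> // /(congr1 val).
(* The square of [tau] negates exactly the fourth and fifth basis vectors, so the common sign there
   decides between exponents 0 and 2. *)
exists (W_perm (proj w)) => //; exists (2 * sign w 0%R i4)%N; first by rewrite mul2n odd_double.
have t2 : proj (tau ^+ 2)%g = 1%g by rewrite expgS expg1 projM proj_tau tperm2.
have [w40|w41] : sign w 0 i4 = 0 \/ sign w 0 i4 = 1.
  by elim/Z2_ind: (sign w 0 i4); [left|right].
  rewrite w40 muln0 expg0 mulg1; apply: W_eqP; first by rewrite proj_W_perm.
  rewrite sign_W_perm; apply/rowP; elim/I5_ind; rewrite [RHS]mxE.
  - by apply: sg_sign0; rewrite w1 // oI !inE.
  - by apply: sg_sign0; rewrite w1 // oI !inE.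
  - by apply: sg_sign0; rewrite w1 // oI !inE.
  - by [].
  - by rewrite -(sg_inj w45).
rewrite w41 muln1; apply: W_eqP; first by rewrite (projM (W_perm _)) t2 proj_W_perm mulg1.
apply/rowP => i; rewrite signM sign_W_perm expgS expg1 signM sign_tau projM proj_tau tperm2.
rewrite tpermV !mxE; elim/I5_ind: i; rewrite ?permE.
- by rewrite (sg_sign0 (w1 i1 _)) ?oI ?inE //; apply/eqP.
- by rewrite (sg_sign0 (w1 i2 _)) ?oI ?inE //; apply/eqP.
- by rewrite (sg_sign0 (w1 i3 _)) ?oI ?inE //; apply/eqP.
- by rewrite w41; apply/eqP.
by rewrite -(sg_inj w45) w41; apply/eqP.
Qed.

(** The operation [\x] returns the empty set unless both conditions hold, and by [S3_tau_dprod] its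
    value contains 1. *)
Lemma S3_tau_direct : S3 :&: <[tau]>%g = 1%g /\ <[tau]>%g \subset 'C(S3)%g.
Proof.
have ST1 : 1%g \in (S3 * <[tau]>)%g.
  by rewrite -[1%g]mulg1 mem_mulg ?group1 // (group1 S3_group).
move: ST1; rewrite -S3_tau_dprod /direct_product.
case: ifP => [ti|_]; last by rewrite inE.
rewrite /central_product; case: ifP => [cT _|_]; last by rewrite inE.
split=> //; apply/eqP; rewrite eqEsubset ti sub1set in_setI.
by rewrite (group1 S3_group) group1.
Qed.

Lemma remgr_S3_tau x k : x \in S3 -> remgr S3 <[tau]> (x * tau ^+ k)%g = (tau ^+ k)%g.
Proof.
by move=> xS; rewrite (@remgrMid _ S3_group <[tau]>%G S3_tau_direct.1) // mem_cycle.
Qed.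

Lemma fixes_or_flips_c_I w : fixes w c_I \/ flips w c_I ->
  exists2 x, x \in S3 & exists2 k, (odd k <-> flips w c_I) & w = (x * tau ^+ k)%g.
Proof.
case=> cw.
  have [x xS [k k0 wE]] := fixes_c_I cw; exists x => //; exists k => //.
  by rewrite (negPf k0); split=> // /(fixes_flips cw).
have [x xS [k k0 wE]] := fixes_c_I (flipsM cw flips_tau).
(* The product of w with [tau] fixes [c_I], and the inverse of [tau] is its cube. *)
exists x => //; exists (k + 3)%N; first by rewrite oddD (negPf k0).
by rewrite expgD mulgA -wE -mulgA -expgS tau_exp4 mulg1.
Qed.

(** The elements of S3 x <tau> are those that fix or flip [c_I], with flips given by the odd powers
    of [tau]. Surjectivity onto <tau> amounts to the presence of an odd power. *)
Lemma normalised_typeIE G : normalised_typeI G <-> twisted G c_I.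
Proof.
split=> [[/subsetP GS GT]|/twistedP[GI [w wG wI]]].
  have xk x k : x \in S3 ->
      (if odd k then flips else fixes) (x * tau ^+ k)%g c_I.
    move=> /S3_fixes xI; have := tau_expg k.
    by case: (odd k) => h; [apply: fixes_flipsM xI h | apply: fixesM xI h].
  apply/twistedP; split=> [w /GS/mulsgP[x _ xS /cycleP[k ->] ->]|].
    by have := xk x k xS; case: ifP; auto.
  have /imsetP[w wG wE] : tau \in [set remgr S3 <[tau]>%g w | w in G].
    by rewrite GT cycle_id.
  exists w => //; rewrite (divgr_eq S3 <[tau]>%g w) -wE.
  by have := xk _ 1%N (mem_divgr (GS w wG)); rewrite expg1.
have GS v : v \in G -> v \in (S3 * <[tau]>)%g.
  move=> /GI/fixes_or_flips_c_I[x xS [k _ ->]].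
  by rewrite mem_mulg // mem_cycle.
split; first exact/subsetP.
apply/eqP; rewrite eqEsubset; apply/andP; split.
  by apply/subsetP => _ /imsetP[v /GS vS ->]; apply: mem_remgr.
have [x xS [k [_ /(_ wI) k1] wE]] := fixes_or_flips_c_I (or_intror wI).
have ctx : commute x (tau ^+ k)%g.
  by apply/esym/(centsP S3_tau_direct.2); rewrite ?mem_cycle.
(* An odd k is its own inverse modulo 4, so this power of w projects to [tau ^+ m]. *)
apply/subsetP => _ /cycleP[m ->]; apply/imsetP; exists (w ^+ (k * m))%g.
  by rewrite groupX.
rewrite wE (expgMn _ ctx) -expgM remgr_S3_tau; last by rewrite (groupX (G := S3_group)).
rewrite -(expg_mod _ tau_exp4) -[in RHS](expg_mod _ tau_exp4); congr (_ ^+ _)%g.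
have k4 : (k * k = 1 %[mod 4])%N by lia.
by rewrite mulnA -modnMml k4 modnMml mul1n.
Qed.

Lemma perm_imset_eq (p : 'S_5) (A B : {set 'I_5}) :
  (forall i, (p i \in B) = (i \in A)) <-> p @: A = B.
Proof.
split=> [pAB|<- i]; last by rewrite mem_imset //; apply: perm_inj.
apply/setP => i; rewrite -[i](permKV p) pAB mem_imset //; exact: perm_inj.
Qed.

Lemma W_act_e_eqN w i :
  W_act w (e_ i) = - e_ i <-> proj w i = i /\ sg 'Z_4 w i = -1.
Proof.
have e_E : W_act w (e_ i) = - e_ i <->
    forall j, (-1) ^+ sign w 0 (proj w j) * (j == i)%:R = - (proj w j == i)%:R :> rat.
  split=> [/(congr1 val)/rowP h j|h].
    by have := h (proj w j); rewrite !mxE permK.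
  by apply/val_inj/rowP => j; rewrite -[j](permKV (proj w)) !mxE permK h.
have sN : sg 'Z_4 w i = -1 <-> sign w 0 i = 1.
  by rewrite /sg; elim/Z2_ind: (sign w 0 i); split=> // /(congr1 val).
split=> [/e_E h|[wi /sN si]].
  have := h i; rewrite eqxx mulr1; have [wi|_] := eqVneq (proj w i) i.
    rewrite wi => s1; split=> //; apply/sN.
    by move: s1; elim/Z2_ind: (sign w 0 i).
  by rewrite oppr0; elim/Z2_ind: (sign w 0 (proj w i)).
apply/e_E => j; have [->|ji] := eqVneq j i; first by rewrite wi eqxx si.
by rewrite -[X in _ == X]wi (inj_eq perm_inj) (negPf ji) mulr0 oppr0.
Qed.

Lemma zerosE c i : (i \in zeros c) = (i \notin odds c) && (i \notin twos c).
Proof. by rewrite !inE; elim/Z4_ind: (c 0 i). Qed.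

Lemma twosE c i : (i \in twos c) = (i \notin odds c) && (i \notin zeros c).
Proof. by rewrite !inE; elim/Z4_ind: (c 0 i). Qed.

Lemma sg_mul2 w i : sg 'Z_4 w i * 2 = 2.
Proof. by case: (sgP 'Z_4 w i) => ->; apply/eqP. Qed.

Lemma c_II_odds_perm w i : proj w i1 = i1 ->
  (proj w i \in odds c_II) = (i \in odds c_II).
Proof.
by case: c_II_parts => -> _ _ w1; rewrite !inE -{1}w1 (inj_eq perm_inj).
Qed.

Lemma swaps_c_II w : proj w i1 = i1 ->
  swaps_24_35 (proj w) <-> proj w @: twos c_II = zeros c_II.
Proof.
have [_ zI tI] := c_II_parts; rewrite /swaps_24_35 -zI -tI => w1.
split=> [[]//|wT]; split=> //; apply/perm_imset_eq => i.
have /perm_imset_eq wTi := wT.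
by rewrite twosE c_II_odds_perm // wTi -zerosE.
Qed.

(** The entries of [c_II] other than the first are 0 or 2, so only the sign at [i1] matters, and the
    image of the twos determines that of the zeros. *)
Lemma c_II_perm w : proj w i1 = i1 ->
  (fixes w c_II <-> sg 'Z_4 w i1 = 1 /\ proj w @: twos c_II = twos c_II) /\
  (flips w c_II <-> sg 'Z_4 w i1 = -1 /\ proj w @: twos c_II = zeros c_II).
Proof.
move=> w1; have [oI _ _] := c_II_parts.
have o1 : i1 \in odds c_II by rewrite oI set11.
have c1 : c_II 0 i1 = 1 by rewrite mxE.
have wO i := c_II_odds_perm i w1.
have part i : [|| i \in odds c_II, i \in zeros c_II | i \in twos c_II].
  by rewrite !inE; elim/Z4_ind: (c_II 0 i).
have cZ i : i \in zeros c_II -> c_II 0 i = 0 by rewrite inE => /eqP.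
have cT i : i \in twos c_II -> c_II 0 i = 2 by rewrite inE => /eqP.
split; split.
- move=> wI; split; first by have := fixes_sg wI o1; rewrite w1 c1 => ->; apply/eqP.
  by apply/perm_imset_eq => i; rewrite fixes_twos.
- move=> [s1 /perm_imset_eq wT]; apply/fixesP => i; case/or3P: (part i) => ic.
  + by move: ic; rewrite oI => /set1P->; rewrite w1 s1 mul1r.
  + by rewrite (cZ _ ic) mulr0 cZ // zerosE wO wT -zerosE.
  + by rewrite (cT _ ic) sg_mul2 cT // wT.
- move=> wI; split; first by have := flips_sg wI o1; rewrite w1 c1 => ->; apply/eqP.
  by apply/perm_imset_eq => i; rewrite flips_zeros.
- move=> [s1 /perm_imset_eq wT]; apply/flipsP => i; case/or3P: (part i) => ic.
  + by move: ic; rewrite oI => /set1P->; rewrite w1 s1 c1; apply/eqP.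
  + rewrite (cZ _ ic) mulr0 cT ?twosE ?wO ?wT -?zerosE //; exact/eqP.
  + by rewrite (cT _ ic) sg_mul2 cZ ?wT // add0r.
Qed.

(** By [c_II_perm], condition (ii), which ties the sign at [i1] to the exchange of the two blocks,
    says that each element fixes or flips [c_II]; condition (iii) provides a flip. *)
Lemma normalised_typeIIE G : normalised_typeII G <-> twisted G c_II.
Proof.
have [oI zI tI] := c_II_parts.
have TZ : twos c_II <> zeros c_II.
  by rewrite zI tI => /setP/(_ i2); rewrite !inE.
split=> [[G1 G2 [w0 w0G w01]]|/twistedP[GI [w0 w0G w0I]]].
  have sgN w : w \in G -> proj w i1 = i1 ->
      (proj w @: twos c_II = zeros c_II <-> sg 'Z_4 w i1 = -1).
    move=> wG w1; rewrite -(swaps_c_II w1) (G2 w wG) W_act_e_eqN.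
    by split=> [[]|].
  apply/twistedP; split=> [w wG|].
    have [w1] := G1 w wG; rewrite -tI -zI => -[wT|wZ]; [left|right].
      apply/(c_II_perm w1).1; split=> //.
      by case: (sgP 'Z_4 w i1) => // /(sgN w wG w1); rewrite wT => /TZ.
    by apply/(c_II_perm w1).2; split=> //; apply/(sgN w wG w1).
  have [w1 s1] := (W_act_e_eqN w0 i1).1 w01; exists w0 => //.
  by apply/(c_II_perm w1).2; split=> //; apply/(sgN w0 w0G w1).
have G1 w : w \in G -> proj w i1 = i1.
  move=> /GI[] wI; apply/set1P; rewrite -oI; first by rewrite fixes_odds // oI set11.
  by rewrite flips_odds // oI set11.
have sgN w : w \in G -> (flips w c_II <-> W_act w (e_ i1) = - e_ i1).
  move=> wG; have w1 := G1 w wG; have [h1 h2] := c_II_perm w1.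
  rewrite W_act_e_eqN; split=> [/h2[]//|[_ s1]].
  by case: (GI w wG) => // /h1[]; rewrite s1 => /(congr1 val).
split=> [w wG|w wG|]; last by exists w0 => //; apply/(sgN w0 w0G).
  have w1 := G1 w wG; split=> //; rewrite -tI -zI.
  by case: (GI w wG) => [/(c_II_perm w1).1|/(c_II_perm w1).2] []; auto.
have w1 := G1 w wG; rewrite (swaps_c_II w1) -(sgN w wG); split=> [wT|].
  by case: (GI w wG) => // /(c_II_perm w1).1[_]; rewrite wT => /esym/TZ.
by move/(c_II_perm w1).2 => [].
Qed.

(** A flip leaves as many zeros as twos, so three odd entries determine all part sizes, and
    [wact_transitive] moves c to [c_I]. One odd entry leads to [c_II] in the same way. *)
Lemma typeI_twisted G : typeI G <-> exists2 c, twisted G c & #|odds c| = 3%N.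
Proof.
split=> [[w /normalised_typeIE/(twisted_conj w^-1%g)]|[c cG c3]].
  rewrite /= conjsgK => cG; exists (wact w^-1%g c_I) => //.
  by rewrite card_odds_wact card_odds_c_I.
have /twistedP[_ [u _ cu]] := cG.
have [w wE] : exists w, wact w c = c_I.
  apply: wact_transitive; rewrite ?c3 ?card_odds_c_I //.
  have := flips_card flips_tau; have := flips_card cu.
  have := card_parts c_I; have := card_parts c; rewrite c3 card_odds_c_I; lia.
by exists w; apply/normalised_typeIE; rewrite -wE; apply: twisted_conj.
Qed.

Lemma typeII_twisted G : typeII G <-> exists2 c, twisted G c & #|odds c| = 1%N.
Proof.
split=> [[w /normalised_typeIIE/(twisted_conj w^-1%g)]|[c cG c1]].
  rewrite /= conjsgK => cG; exists (wact w^-1%g c_II) => //.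
  by rewrite card_odds_wact card_odds_c_II.
have /twistedP[_ [u _ cu]] := cG.
have [w wE] : exists w, wact w c = c_II.
  apply: wact_transitive; rewrite ?c1 ?card_odds_c_II //.
  have [_ -> _] := c_II_parts; rewrite cards2 (_ : (i3 != i5) = true) //.
  have := flips_card cu; have := card_parts c; rewrite c1; lia.
by exists w; apply/normalised_typeIIE; rewrite -wE; apply: twisted_conj.
Qed.

Lemma twisted_type (G : {group W}) c : twisted G c -> typeI G \/ typeII G.
Proof.
move=> cG; have /twistedP[_ [w _ /flips_odds_card[]]] := cG => c13.
  by right; apply/typeII_twisted; exists c.
by left; apply/typeI_twisted; exists c.
Qed.

(** * Subgroups of order four *)

Lemma twisted_cycle u d : flips u d -> twisted <[u]>%g d.
Proof.
move=> ud; apply/twistedP; split; last by exists u => //; apply: cycle_id.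
move=> _ /cycleP[k ->]; elim: k => [|k [IHk|IHk]]; first by left; apply: fixes1.
  by right; rewrite expgSr; apply: fixes_flipsM IHk ud.
by left; rewrite expgSr; apply: flipsM IHk ud.
Qed.

Lemma order4 (u : W) : (u ^+ 4 = 1)%g -> (u ^+ 2 <> 1)%g -> #[u]%g = 4%N.
Proof.
move=> u4 u2; have : (#[u]%g %| 4)%N by rewrite order_dvdn u4.
have : ~~ (#[u]%g %| 2)%N by rewrite order_dvdn; apply/eqP.
have := order_gt0 u; case: #[u]%g => [|[|[|[|[|n]]]]] // _ _ /dvdn_leq; lia.
Qed.

(** At most two elements fix c, and the square of the flip u is a nontrivial one of them, so u has
    order 4. Any other flip differs from u by an element fixing c, so u generates G. *)
Lemma typeI_typeII_card (G : {group W}) c d : twisted G c -> twisted G d ->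
  #|odds c| = 3%N -> #|odds d| = 1%N -> #|G| = 4%N.
Proof.
move=> cG dG c3 d1; have /twistedP[cG1 [u uG uc]] := cG.
have ud : flips u d by apply: twisted_flips cG dG uG uc.
have cG2 := flips_card uc; have dG2 := flips_card ud.
have := card_parts c; have := card_parts d; rewrite c3 d1 => d5 c5.
have /eqP/cards1P[z zE] : #|zeros c| = 1%N by lia.
have /eqP/cards1P[t tE] : #|twos c| = 1%N by lia.
have /eqP/cards1P[i iE] : #|odds d| = 1%N by [].
have d0 : #|zeros d| = 2%N by lia.
have d2 : #|twos d| = 2%N by lia.
have uz : proj u z = t by apply/set1P; rewrite -tE flips_twos // zE set11.
have ut : proj u t = z by apply/set1P; rewrite -zE flips_zeros // tE set11.
have ui : proj u i = i by apply/set1P; rewrite -iE flips_odds // iE set11.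
have zt : z != t.
  apply/eqP => zt; have : z \in zeros c by rewrite zE set11.
  have : z \in twos c by rewrite tE zt set11.
  by rewrite !inE => /eqP->.
have zi : z != i by apply: contraNneq zt => zi; rewrite -uz zi ui.
have ti : t != i by apply: contraNneq zt => ti; rewrite -ut ti ui.
have K1 w : w \in G -> fixes w c -> proj w = 1%g.
  move=> wG wc.
  have wd : fixes w d.
    have /twistedP[/(_ w wG)[//|wd] _] := dG.
    by case: (fixes_flips wc); apply: twisted_flips dG cG wG wd.
  have wz : proj w z = z by apply/set1P; rewrite -zE fixes_zeros // zE set11.
  have wt : proj w t = t by apply/set1P; rewrite -tE fixes_twos // tE set11.
  have wi : proj w i = i by apply/set1P; rewrite -iE fixes_odds // iE set11.
  (* {c_i = 0} = {z} and {c_i = 2} = {t} meet both blocks of d, each of which has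
     two elements, so that w fixes every index. *)
  have pair (A : {set 'I_5}) y j : #|A| = 2%N -> y \in A -> j \in A -> proj w y = y ->
      proj w j \in A -> proj w j = j.
    move=> A2 yA jA wy wjA; have [->//|jy] := eqVneq j y.
    have /eqP/cards1P[x xE] : #|A :\ y| = 1%N by move: A2; rewrite (cardsD1 y) yA => -[].
    have : j \in A :\ y by rewrite !inE jy.
    have : proj w j \in A :\ y by rewrite !inE wjA andbT -wy (inj_eq perm_inj).
    by rewrite xE !inE => /eqP-> /eqP->.
  have zd : (z \in zeros d) || (z \in twos d).
    have := zerosE d z; rewrite iE inE zi /= => ->; by rewrite orNb.
  apply/permP => j; rewrite perm1.
  have [->//|ji] := eqVneq j i.
  have := zerosE d j; rewrite iE inE ji /=; have [j2 _|j2 j0] := boolP (j \in twos d).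
    case/orP: zd => zd; last by apply: (pair (twos d) z); rewrite ?fixes_twos.
    apply: (pair (twos d) t); rewrite ?fixes_twos //.
    by rewrite -uz flips_twos.
  case/orP: zd => zd; first by apply: (pair (zeros d) z); rewrite ?fixes_zeros.
  apply: (pair (zeros d) t); rewrite ?fixes_zeros //.
  by rewrite -uz flips_zeros.
have prodzt w : sg 'Z_4 w z * sg 'Z_4 w t = \prod_(j in odds c) sg 'Z_4 w j.
  have := prod_sg 'Z_4 w; rewrite (bigID (mem (odds c))) /=.
  have -> : \prod_(j | j \notin odds c) sg 'Z_4 w j = sg 'Z_4 w z * sg 'Z_4 w t.
    rewrite (bigD1 z) /=; last by have := zerosE c z; rewrite zE set11 => /esym/andP[].
    rewrite (bigD1 t) /=; last first.
      by have := twosE c t; rewrite tE set11 eq_sym zt => /esym/andP[-> _].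
    rewrite big_pred0 ?mulr1 // => j; apply/negP => /andP[/andP[jo jz] jt].
    by have := zerosE c j; rewrite zE tE !inE in jo * ; rewrite jo (negPf jz) (negPf jt).
  set P := \prod_(j in _) _.
  case: (sgP 'Z_4 w z) => ->; case: (sgP 'Z_4 w t) => ->;
    rewrite ?(mulr1, mul1r, mulrN1, mulN1r, opprK) => // /(congr1 -%R);
    by rewrite ?opprK => ->.
(* A fixing element has trivial permutation, sign 1 on the odd entries of c and, by [prodzt], equal
   signs at z and t: its sign at z determines it. *)
have K w v : w \in G -> v \in G -> fixes w c -> fixes v c ->
    sg 'Z_4 w z = sg 'Z_4 v z -> w = v.
  move=> wG vG wc vc wvz.
  have wv1 := K1 w wG wc; have v1 := K1 v vG vc.
  have odd1 x : x \in G -> fixes x c -> forall j, j \in odds c -> sg 'Z_4 x j = 1.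
    move=> xG xc j jc; have := fixes_sg xc jc; rewrite (K1 x xG xc) perm1 => ->.
    by move: jc; rewrite inE; elim/Z4_ind: (c 0 j) => // _; apply/eqP.
  have wvt : sg 'Z_4 w t = sg 'Z_4 v t.
    have := prodzt w; have := prodzt v; rewrite wvz !big1; try exact: odd1.
    by case: (sgP 'Z_4 v z) => ->; rewrite ?mul1r ?mulN1r;
      first [by move=> -> -> | by move=> <- /oppr_inj].
  apply: W_eqP; first by rewrite wv1.
  apply/rowP => j; apply: sg_inj.
  have [jo|jo] := boolP (j \in odds c); first by rewrite !odd1.
  have := zerosE c j; rewrite jo zE tE !inE.
  have [->//|_] := eqVneq j z; have [->//|//] := eqVneq j t.
have uuG : (u * u)%g \in G by rewrite groupM.
have uuc := flipsM uc uc.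
(* As u exchanges z and t, this is the product of its signs there, that is, (-1)^3 by [prodzt] and
   [flips_prod_sg]. *)
have uuz : sg 'Z_4 (u * u)%g z = -1.
  by rewrite -{1}ut sgMV ut mulrC prodzt (flips_prod_sg uc) c3; apply/eqP.
have u4 : (u ^+ 4 = 1)%g.
  rewrite (_ : u ^+ 4 = u * u * (u * u))%g; last by rewrite !expgS expg0 mulg1 !mulgA.
  apply: (K _ 1%g (groupM uuG uuG) (group1 G) (fixesM uuc uuc) (fixes1 c)).
  by rewrite -{1}[z](perm1 z) -{1}(K1 _ uuG uuc) sgMV (K1 _ uuG uuc) perm1 uuz sg1; apply/eqP.
have o4 : #[u]%g = 4%N.
  apply: order4 => //; rewrite expgS expg1 => u2.
  by move: uuz; rewrite u2 sg1 => /(congr1 val).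
rewrite -o4; apply/eqP; rewrite eqn_leq; apply/andP.
split; apply: subset_leq_card; last by rewrite cycle_subG.
apply/subsetP => w wG.
have K0 v : v \in G -> fixes v c -> v \in <[u]>%g.
  move=> vG vc; case: (sgP 'Z_4 v z) => vz.
    by rewrite (K v 1%g) ?group1 ?fixes1 ?sg1.
  by rewrite (K v _ vG uuG vc uuc) ?uuz // groupM ?cycle_id.
case: (cG1 w wG) => wc; first exact: K0.
by have := K0 _ (groupM wG uG) (flipsM wc uc); rewrite (groupMr _ (cycle_id u)).
Qed.

(** The sign of u at the odd index is -1, so its signs at the other four indices have product -1.
    Since u^4 = 1, these indices form two 2-cycles, and u^2 acts as -1 on exactly one of them. Hence
    u generates G, and a vector with three odd entries flipped by u suffices. *)
Lemma typeII_card4_typeI (G : {group W}) c : twisted G c ->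
  #|odds c| = 1%N -> #|G| = 4%N -> exists2 d, twisted G d & #|odds d| = 3%N.
Proof.
move=> /twistedP[_ [u uG uc]] c1 G4.
have u4 : (u * u * (u * u) = 1)%g.
  have : (u ^+ 4 = 1)%g by rewrite -G4 expg_cardG.
  by rewrite !expgS expg0 mulg1 !mulgA.
have := flips_card uc; have := card_parts c; rewrite c1 => c5 c02.
have /eqP/cards1P[i iE] : #|odds c| = 1%N by [].
have ui : proj u i = i by apply/set1P; rewrite -iE flips_odds // iE set11.
have si : sg 'Z_4 u i = -1.
  by have := flips_prod_sg uc; rewrite c1 iE big_set1 => ->; apply/eqP.
have /eqP/cards2P[x [y [xy zE]]] : #|zeros c| = 2%N by lia.
have ux : proj u x \in twos c by rewrite flips_twos // zE !inE eqxx.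
have uy : proj u y \in twos c by rewrite flips_twos // zE !inE eqxx orbT.
have uxy : proj u x != proj u y by rewrite (inj_eq perm_inj).
have tE : twos c = [set proj u x; proj u y].
  apply/esym/eqP; rewrite eqEcard; apply/andP; split; last by rewrite cards2 uxy; lia.
  by apply/subsetP => j; rewrite in_set2 => /orP[]/eqP->.
have uux : proj u (proj u x) \in [set x; y] by rewrite -zE flips_zeros.
have uuy : proj u (proj u y) \in [set x; y] by rewrite -zE flips_zeros.
have sprod : sg 'Z_4 u x * sg 'Z_4 u y * (sg 'Z_4 u (proj u x) * sg 'Z_4 u (proj u y)) = -1.
  have := prod_sg 'Z_4 u.
  have -> : \prod_j sg 'Z_4 u j = \prod_(j in odds c) sg 'Z_4 u j *
     (\prod_(j in zeros c) sg 'Z_4 u j * \prod_(j in twos c) sg 'Z_4 u j).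
    rewrite (bigID (mem (odds c))) /=; congr (_ * _).
    rewrite (bigID (mem (zeros c))) /=; congr (_ * _); apply: eq_bigl => j.
      by rewrite zerosE; case: (_ \in odds c) => //=.
    by rewrite twosE.
  rewrite iE zE tE big_set1 si !big_setU1 ?inE // !big_set1 mulN1r => /(congr1 -%R).
  by rewrite opprK.
have uu : proj u (proj u x) = x /\ proj u (proj u y) = y.
  have : proj u (proj u x) != proj u (proj u y) by rewrite !(inj_eq perm_inj).
  move: uux uuy; rewrite !inE.
  (* Otherwise the four indices form a 4-cycle, and u^4 would multiply e_x by the product of their
     signs, which is -1. *)
  case/orP => /eqP e1 /orP[] /eqP e2; rewrite e1 e2 ?eqxx // => _; exfalso.
  have ex : proj (u * u)%g x = y by rewrite projM permM.
  have ey : proj (u * u)%g y = x by rewrite projM permM.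
  have sx : sg 'Z_4 (u * u)%g x = sg 'Z_4 u (proj u y) * sg 'Z_4 u x.
    by rewrite -{1}e2 sgMV e2.
  have sy : sg 'Z_4 (u * u)%g y = sg 'Z_4 u (proj u x) * sg 'Z_4 u y.
    by rewrite -{1}e1 sgMV e1.
  have := sg1 'Z_4 x; rewrite -u4 -{1}ey sgMV ey sx sy => /(congr1 val).
  suff -> : sg 'Z_4 u (proj u x) * sg 'Z_4 u y * (sg 'Z_4 u (proj u y) * sg 'Z_4 u x) = -1 by [].
  by rewrite -sprod; ring.
have ord2 a b : a \in zeros c -> b \in zeros c -> proj u (proj u a) = a ->
    proj u (proj u b) = b -> a != b -> sg 'Z_4 u (proj u a) * sg 'Z_4 u a = -1 ->
    sg 'Z_4 u (proj u b) * sg 'Z_4 u b = 1 ->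
    exists2 d, twisted G d & #|odds d| = 3%N.
  move=> az bz ua ub ab sa sb.
  have uua : sg 'Z_4 (u * u)%g a = -1 by rewrite -{1}ua sgMV ua.
  have o4 : #[u]%g = 4%N.
    apply: order4; first by rewrite -u4 !expgS expg0 mulg1 !mulgA.
    by rewrite expgS expg1 => u2; move: uua; rewrite u2 sg1 => /(congr1 val).
  have GE : <[u]>%g = G.
    by apply/eqP; rewrite eqEcard cycle_subG uG G4 -o4 leqnn.
  (* u maps e_a to +-e_(u a) and that to -+e_a, whereas it is an involution on
     the plane of e_b and e_(u b), which thus contributes two odd entries. *)
  pose d : 'rV['Z_4]_5 := \row_j if j == a then 0 else if j == proj u a then 2
    else if j == proj u b then - sg 'Z_4 u (proj u b) else 1.
  have neq j k : j \in zeros c -> k \in twos c -> (j == k) = false.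
    by move=> jz; apply: contraTF => /eqP <-; move: jz; rewrite !inE => /eqP->.
  have uat : proj u a \in twos c by rewrite flips_twos.
  have ubt : proj u b \in twos c by rewrite flips_twos.
  have da : d 0 a = 0 by rewrite mxE eqxx.
  have dua : d 0 (proj u a) = 2 by rewrite mxE eq_sym neq // eqxx.
  have dub : d 0 (proj u b) = - sg 'Z_4 u (proj u b).
    by rewrite mxE eq_sym neq // (inj_eq perm_inj) eq_sym (negPf ab) eqxx.
  have db : d 0 b = 1 by rewrite mxE eq_sym (negPf ab) !neq.
  have io : i \in odds c by rewrite iE set11.
  have di : d 0 i = 1.
    have iN j : j \notin odds c -> (i == j) = false.
      by apply: contraNF => /eqP <-.
    have ao : a \notin odds c by move: az; rewrite zerosE => /andP[].
    have bo : b \notin odds c by move: bz; rewrite zerosE => /andP[].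
    by rewrite mxE !iN // flips_odds.
  have ud : flips u d.
    apply/flipsP => j; have [jo|jo] := boolP (j \in odds c).
      by move: jo; rewrite iE => /set1P->; rewrite ui si di; apply/eqP.
    have : j \in [set a; b; proj u a; proj u b].
      have : [set a; b] = [set x; y].
        by rewrite -zE; apply/eqP; rewrite eqEcard subUset !sub1set az bz zE !cards2 ab xy.
      move=> abE; have := zerosE c j; rewrite jo tE /=.
      have -> : [set proj u x; proj u y] = [set proj u a; proj u b].
        by rewrite -!(imset_set1 (proj u)) -!imsetU abE.
      by rewrite zE -abE !inE; case: (j == a); case: (j == b); case: (j == _); case: (j == _).
    rewrite !inE -!orbA => /or4P[]/eqP->.
    - by rewrite da dua mulr0; apply/eqP.
    - by rewrite db dub mulr1; case: (sgP 'Z_4 u (proj u b)) => ->; apply/eqP.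
    - by rewrite ua da dua sg_mul2 add0r.
    - rewrite ub db dub mulrN mulrC sb; exact/eqP.
  exists d; first by rewrite -GE; apply: twisted_cycle.
  (* The entries at i and b are both odd, which rules out a single odd entry. *)
  case: (flips_odds_card ud) => // /eqP/cards1P[k kE].
  have : i \in odds d by rewrite inE di.
  have : b \in odds d by rewrite inE db.
  rewrite kE !inE => /eqP bk /eqP ik.
  by move: io bz; rewrite ik -bk zerosE => ->.
have xz : x \in zeros c by rewrite zE !inE eqxx.
have yz : y \in zeros c by rewrite zE !inE eqxx orbT.
have sxy : sg 'Z_4 u (proj u x) * sg 'Z_4 u x * (sg 'Z_4 u (proj u y) * sg 'Z_4 u y) = -1.
  by rewrite -sprod; ring.
have unit1 j k : sg 'Z_4 u j * sg 'Z_4 u k = 1 \/ sg 'Z_4 u j * sg 'Z_4 u k = -1.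
  by case: (sgP 'Z_4 u j) => ->; case: (sgP 'Z_4 u k) => ->;
    rewrite ?(mul1r, mulN1r, opprK); auto.
case: uu => ux2 uy2; case: (unit1 (proj u x) x) => sx.
  move: sxy; rewrite sx mul1r => sy.
  by apply: (ord2 y x) => //; rewrite eq_sym.
apply: (ord2 x y) => //; move: sxy; rewrite sx mulN1r => /(congr1 -%R).
by rewrite !opprK.
Qed.

(** * Structure of the first cohomology group *)

Lemma zmod_iso_of_bij (A B : zmodType) (f : B -> A) :
  zmod_morphism f -> injective f -> (forall y, exists x, f x = y) -> zmod_iso A B.
Proof.
move=> fM fI fS; have [g gK] := choice fS.
have gM : zmod_morphism g by move=> x y; apply: fI; rewrite fM !gK.
pose gA : {additive A -> B} := HB.pack g (GRing.isZmodMorphism.Build A B g gM).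
by exists gA, f => [y|x]; [rewrite gK | apply: fI; rewrite gK].
Qed.

Lemma mulrn_Zp_B (A : zmodType) (y : A) p (a b : 'I_p.+1) : y *+ p.+1 = 0 ->
  y *+ (a - b)%R = y *+ a - y *+ b.
Proof.
move=> yp; have modE m : y *+ (m %% p.+1) = y *+ m.
  by rewrite [in RHS](divn_eq m p.+1) mulrnDr mulnC mulrnA yp mul0rn add0r.
by rewrite /= modE mulrnDr modE mulrnBr ?(ltnW (ltn_ord b)) // yp sub0r.
Qed.

(** * Abelian groups that are the union of their 2-torsion and one coset of it *)

Section ExponentFour.

Variables (A : zmodType) (x : A).
Hypotheses (x4 : x *+ 4 = 0) (x2 : x *+ 2 <> 0).
Hypothesis doubling : forall y, y *+ 2 = 0 \/ (y - x) *+ 2 = 0.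

(** Injective but not necessarily surjective: such a map is enlarged by one factor Z/2 at a time
    until it is onto. *)
Definition partial_iso e (f : 'Z_4 * 'rV['Z_2]_e -> A) :=
  [/\ zmod_morphism f, forall u, f u = 0 -> u = 0 & f (1, 0) = x].

Lemma partial_iso0 : exists f, @partial_iso 0 f.
Proof.
exists (fun u : 'Z_4 * 'rV['Z_2]_0 => x *+ u.1); split=> [[a u] [b v]|[a u]|] /=.
- exact: mulrn_Zp_B.
- rewrite [u]thinmx0; elim/Z4_ind: a => // [x1|x3]; case: x2.
    by rewrite [x]x1 mul0rn.
  (* If 3 x = 0 then 6 x = 0, while 6 x = 2 x because 4 x = 0. *)
  have <- : x *+ 6 = x *+ 2 by rewrite -[in RHS](add0r (x *+ 2)) -x4 -mulrnDr.
  by rewrite (mulrnA _ 3 2) [x *+ 3]x3 mul0rn.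
- exact: mulr1n.
Qed.

(** By [doubling], y or y - x is killed by 2. Since x lies in the image, neither of the two does, so
    the one killed by 2 spans a new independent factor. *)
Lemma partial_isoS e f y : @partial_iso e f -> (forall u, f u <> y) ->
  exists g, @partial_iso e.+1 g.
Proof.
move=> [fM fK f1] fy.
have f0 : f 0 = 0 by rewrite -(subrr (0 : 'Z_4 * 'rV['Z_2]_e)%type) fM subrr.
have fN u : f (- u) = - f u by rewrite -[- u]sub0r fM f0 sub0r.
have fD u v : f (u + v) = f u + f v by rewrite -[v]opprK fM (fN (- v)) fN opprK.
have [z z2 fz] : exists2 z, z *+ 2 = 0 & forall u, f u <> z.
  case: (doubling y) => [y2|yx2]; first by exists y.
  exists (y - x) => // u fu; case: (fy (u + (1, 0))).
  by rewrite fD fu f1 subrK.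
exists (fun u : 'Z_4 * 'rV['Z_2]_(1 + e) => f (u.1, rsubmx u.2) + z *+ u.2 0 0).
split=> [[a u] [b v]|[a u] /= fu|] /=.
- rewrite !mxE (mulrn_Zp_B (p := 1)) // opprD addrACA -fM.
  by congr (f (_, _) + _); apply/rowP => i; rewrite !mxE.
- have u0 : u 0 0 = 0.
    move: fu; elim/Z2_ind: (u 0 0) => // fu.
    case: (fz (- (a, @rsubmx _ 1 1 e u))); rewrite fN; apply/eqP.
    by rewrite eqr_oppLR -addr_eq0; apply/eqP.
  move: fu; rewrite u0 mulr0n addr0 => /fK[-> ur].
  congr (_, _); rewrite -[LHS](@hsubmxK _ 1 1 e) ur.
  have -> : @lsubmx _ 1 1 e u = 0.
    by apply/rowP => i; rewrite !mxE [i]ord1 -[RHS]u0; congr (u _ _); apply/val_inj.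
  exact: (@row_mx0 _ 1 1 e).
- rewrite mxE mulr0n addr0 -f1; congr (f (_, _)).
  by apply/rowP => i; rewrite !mxE.
Qed.

(** The 2-torsion of the source has order 2^(e+1): 0 and 2 in Z/4, and all of the other factor. It
    embeds into E through f and h. *)
Lemma partial_iso_bound e f n (T : finType) (E : {set T}) (h : A -> T) :
  @partial_iso e f -> (#|E| <= 2 ^ n.+1)%N ->
  (forall y, y *+ 2 = 0 -> h y \in E) ->
  (forall y z, y *+ 2 = 0 -> z *+ 2 = 0 -> h y = h z -> y = z) -> (e <= n)%N.
Proof.
move=> [fM fK f1] En hE hI.
have fI u v : f u = f v -> u = v.
  by move=> uv; apply/eqP; rewrite -subr_eq0; apply/eqP/fK; rewrite fM uv subrr.
have f0 : f 0 = 0 by rewrite -(subrr (0 : 'Z_4 * 'rV['Z_2]_e)%type) fM subrr.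
have fN u : f (- u) = - f u by rewrite -[- u]sub0r fM f0 sub0r.
have fD u v : f (u + v) = f u + f v by rewrite -[v]opprK fM (fN (- v)) fN opprK.
pose g (t : bool * 'rV['Z_2]_e) : 'Z_4 * 'rV['Z_2]_e := (if t.1 then 2 else 0, t.2).
have g2 t : f (g t) *+ 2 = 0.
  rewrite mulr2n -fD -f0; congr f; case: t => b v; congr (_, _).
    by case: b; apply/eqP.
  by apply/rowP => i; rewrite !mxE; elim/Z2_ind: (v 0 i); apply/eqP.
have gI : injective g by move=> [[] v] [[] w] // [->].
have : (#|[set h (f (g t)) | t in [set: bool * 'rV['Z_2]_e]]| <= #|E|)%N.
  by apply: subset_leq_card; apply/subsetP => _ /imsetP[t _ ->]; apply: hE.
rewrite card_imset => [|s t st]; last by apply/gI/fI/hI.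
rewrite cardsT card_prod card_bool card_mx card_ord mul1n -expnS => le2.
by have := leq_trans le2 En; rewrite leq_exp2l.
Qed.

Lemma zmod_iso_Z4_Z2 n (T : finType) (E : {set T}) (h : A -> T) :
  (#|E| <= 2 ^ n.+1)%N -> (forall y, y *+ 2 = 0 -> h y \in E) ->
  (forall y z, y *+ 2 = 0 -> z *+ 2 = 0 -> h y = h z -> y = z) ->
  exists2 e, (e <= n)%N & zmod_iso A ('Z_4 * 'rV['Z_2]_e)%type.
Proof.
move=> En hE hI; have [f fP] := partial_iso0.
have bound e (f' : 'Z_4 * 'rV['Z_2]_e -> A) (f'P : partial_iso f') :=
  partial_iso_bound f'P En hE hI.
(* The fuel k bounds the number of extensions still possible before e would exceed n. *)
suff main k e (f' : 'Z_4 * 'rV['Z_2]_e -> A) : partial_iso f' -> (n < e + k)%N ->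
    exists2 e, (e <= n)%N & zmod_iso A ('Z_4 * 'rV['Z_2]_e)%type.
  exact: main n.+1 0%N f fP _.
elim: k e f' => [|k IHk] e f' f'P nek; first by have := bound e f' f'P; lia.
have [fS|] := pselect (forall y, exists u, f' u = y).
  exists e; first exact: bound f'P.
  have [fM fK _] := f'P; apply: (zmod_iso_of_bij fM) => // u v uv.
  by apply/eqP; rewrite -subr_eq0; apply/eqP/fK; rewrite fM uv subrr.
move=> /existsNP[y /forallNP fy].
by have [g gP] := partial_isoS f'P fy; apply: IHk gP _; rewrite addSnnS.
Qed.

End ExponentFour.

(** * The 2-torsion of the cohomology group *)

Definition oddset (b : 'rV[int]_5) : {set 'I_5} := [set i | odd `|b 0%R i|%N].

Section TwoTorsion.

Variables (G : {group W}) (c : 'rV['Z_4]_5).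
Hypothesis cG : twisted G c.
Notation H := (H1 G W_act).
Implicit Types (b : 'rV[int]_5) (z : H).

Lemma torsion_integral z : z *+ 2 = 0 ->
  exists b, divided_coboundary 2 (emb b) z.
Proof.
move=> z2; have [c' c'z] := represents_exists z.
have [b bz] := torsion_divided c'z z2.
have [v [k bE]] := PicP b.
have [q [r [r4 kE kr]]] := Z4_int k.
(* If b is half-integral, then d = 2 b has only odd entries and represents z,
   which is incompatible with G being twisted by c. *)
have [r1|r0] := boolP (odd r).
  pose d : 'rV[int]_5 := \row_i (v 0 i * 2 + k).
  have bd : b *+ 2 = emb d.
    apply/val_inj/rowP => i; rewrite raddfMn mulmxnE bE !mxE.
    by rewrite rmorphD rmorphM /=; field.
  have d5 : #|odds (bar d)| = 5%N.
    rewrite -[RHS](card_ord 5) -cardsT; congr #|pred_of_set _|.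
    apply/setP => i; rewrite !inE !mxE rmorphD rmorphM /= kr.
    move: r1; case: r r4 {kE kr} => [|[|[|[|//]]]] //= _ _.
      by elim/Z4_ind: (v 0 i)%:~R.
    by elim/Z4_ind: (v 0 i)%:~R.
  have /twistedP[_ [w wG cw]] := cG.
  have [dw|/flips_odds_card] := represents_bar (divided_represents bz bd) wG.
    by have := flips_fixes_odd cw dw; rewrite d5.
  by rewrite d5 => -[].
exists (\row_i (v 0 i + (k %/ 2)%Z)).
suff -> : emb (\row_i (v 0 i + (k %/ 2)%Z)) = b by [].
apply/val_inj/rowP => i; rewrite !mxE bE rmorphD /=; congr (_ + _).
have {2}-> : k = (k %/ 2)%Z * 2 by lia.
by rewrite rmorphM /=; field.
Qed.

Lemma odd_absz_sg w i (a : int) : odd `|sg int w i * a| = odd `|a|.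
Proof. by case: (sgP int w i) => ->; rewrite ?mul1r ?mulN1r ?abszN. Qed.

(** The entries of w b - b are 2 v + k with a common k, so they all have the same parity. If they
    were odd, w would exchange the odd set with its complement, which five indices do not allow. *)
Lemma oddset_stable b z w i : divided_coboundary 2 (emb b) z -> w \in G ->
  (proj w i \in oddset b) = (i \in oddset b).
Proof.
move=> [f _ fE] wG; have := fE (subg G w); rewrite subgK // W_act_emb -raddfB.
have [v [k vE]] := PicP (f (subg G w)).
move=> /(congr1 val)/rowP fb.
have bE j : sg int w (proj w j) * b 0 j - b 0 (proj w j) = v 0 (proj w j) * 2 + k.
  apply: (@intr_inj rat); have := fb (proj w j).
  rewrite raddfMn mulmxnE vE !mxE permK => <-.
  by rewrite rmorphD rmorphM /=; field.
have par j : odd `|k| = (j \in oddset b) (+) (proj w j \in oddset b).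
  rewrite !inE -(odd_absz_sg w (proj w j) (b 0 j)); have := bE j.
  move: (sg _ _ _ * _) (b 0 (proj w j)) (v 0 _) => m n l; lia.
have k0 : ~~ odd `|k|.
  apply/negP => k1.
  have : #|oddset b| = #|~: oddset b|.
    rewrite -(card_imset (~: _) (@perm_inj _ (proj w))); congr #|pred_of_set _|.
    apply/esym/perm_imset_eq => j; rewrite [RHS]in_setC.
    by have := par j; rewrite k1; do 2!case: (_ \in oddset b).
  have := cardsC (oddset b); rewrite card_ord; lia.
by have := par i; rewrite (negPf k0); do 2!case: (_ \in oddset b).
Qed.

(** The vector (1, .., 1) is twice a lattice vector, so complementary or equal odd sets make b - b'
    twice a lattice vector. *)
Lemma oddset_inj b b' z z' :
  divided_coboundary 2 (emb b) z -> divided_coboundary 2 (emb b') z' ->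
  oddset b = oddset b' \/ oddset b = ~: oddset b' -> z = z'.
Proof.
move=> bz b'z' bb'.
have [k bk] : exists k : int, forall i, exists q, b 0 i - b' 0 i = q * 2 + k.
  case: bb' => /setP bb'; [exists 0 | exists 1] => i; have := bb' i; rewrite !inE.
    by move=> bi; exists ((b 0%R i - b' 0%R i) %/ 2)%Z; lia.
  by move=> bi; exists ((b 0%R i - b' 0%R i) %/ 2)%Z; lia.
have [q qE] := choice bk.
have [m mE] := Pic_half (\row_i q i) k.
apply/eqP; rewrite -subr_eq0; apply/eqP; apply: (@divided_coboundary_eq0 _ m).
have -> : m *+ 2 = emb b - emb b'.
  rewrite -raddfB; apply/val_inj/rowP => i; rewrite raddfMn mulmxnE mE !mxE qE.
  by rewrite rmorphD rmorphM /=; field.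
exact: divided_coboundaryB.
Qed.

(** Passing to the complement if necessary, the odd set avoids a chosen odd index [i0] of c. It is
    stable under a flip u, so its trace on the zeros of c determines that on the twos. *)
Lemma torsion2_bound : exists (D : {set 'I_5}) (h : H -> {set 'I_5}),
  [/\ (#|D|.+1 = #|odds c| + #|zeros c|)%N,
      forall z, z *+ 2 = 0 -> h z \subset D
    & forall z z', z *+ 2 = 0 -> z' *+ 2 = 0 -> h z = h z' -> z = z'].
Proof.
have /twistedP[_ [u uG uc]] := cG.
have /card_gt0P[i0 i0c] : (0 < #|odds c|)%N by case: (flips_odds_card uc) => ->.
pose D := (odds c :|: zeros c) :\ i0.
pose normal (b : 'rV[int]_5) := if i0 \in oddset b then ~: oddset b else oddset b.
(* Outside the 2-torsion the value of h is the arbitrary default [set0]. *)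
have /boolp.choice[h hP] : forall z, exists S, z *+ 2 = 0 ->
    exists2 b, divided_coboundary 2 (emb b) z & S = normal b :&: D.
  move=> z; have [z2|z2] := pselect (z *+ 2 = 0).
    by have [b bz] := torsion_integral z2; exists (normal b :&: D) => _; exists b.
  by exists set0 => /z2.
exists D, h; split=> [|z /hP[b _ ->]|z z' /hP[b bz ->] /hP[b' b'z' ->] bb'].
- have -> : #|D|.+1 = #|odds c :|: zeros c|.
    by rewrite [RHS](cardsD1 i0) in_setU i0c.
  rewrite cardsU (_ : _ :&: _ = set0) ?cards0 ?subn0 //.
  by apply/setP => i; rewrite in_setI zerosE in_set0; case: (i \in odds c).
- exact: subsetIr.
apply: (oddset_inj bz b'z'); suff: normal b = normal b'.
  rewrite /normal; case: ifP => _; case: ifP => _ bE;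
    first [by left | by right | by left; apply: setC_inj | by right; rewrite -bE setCK].
have n0 d : (i0 \in normal d) = false by rewrite /normal; case: ifP => //; rewrite in_setC => ->.
have nu d (y : H) i : divided_coboundary 2 (emb d) y -> (proj u i \in normal d) = (i \in normal d).
  move=> dy; rewrite /normal; case: ifP => _; rewrite ?in_setC.
    by rewrite (oddset_stable _ dy uG).
  exact: oddset_stable dy uG.
have main i : (i \in odds c) || (i \in zeros c) -> (i \in normal b) = (i \in normal b').
  move=> iD; have [->|ii0] := eqVneq i i0; first by rewrite !n0.
  have := congr1 (fun S : {set _} => i \in S) bb'; rewrite /= !in_setI.
  by rewrite !in_setD1 ii0 in_setU iD !andbT.
apply/setP => i; have [iD|] := boolP ((i \in odds c) || (i \in zeros c)); first exact: main.
rewrite negb_or -twosE => it; rewrite -(nu _ _ _ bz) -(nu _ _ _ b'z'); apply: main.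
by rewrite flips_zeros // it orbT.
Qed.

End TwoTorsion.

(** * The quotient by the 2-torsion and the conclusion *)

Lemma pi_torsion2_eq (G : {group W}) (y z : H1 G W_act) :
  \pi_(H1_mod_torsion2 G) y = \pi_(H1_mod_torsion2 G) z <-> (y - z) *+ 2 = 0.
Proof.
split=> [/eqP|yz]; first by rewrite -Quotient.idealrBE => /eqP.
by apply/eqP; rewrite -Quotient.idealrBE; apply/eqP.
Qed.

Lemma torsion2_dichotomy (G : {group W}) c (x : H1 G W_act) :
  represents c x -> twisted G (bar c) ->
  forall y, y *+ 2 = 0 \/ (y - x) *+ 2 = 0.
Proof.
move=> cx cG y; have [d dy] := represents_exists y.
have [y2|y2] := pselect (y *+ 2 = 0); [by left | right].
exact: (twisted_torsion dy cx (represents_twisted dy y2) cG).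
Qed.

(** The cocycle of alpha is a quarter of the coboundary of c, so by [torsion2_dichotomy] every class
    is 0 or alpha modulo 2-torsion. *)
Lemma iota_generates_twisted (G : {group W}) c :
  twisted G (bar c) -> iota_generates G (emb c).
Proof.
move=> cG; have /twistedP[cG1 _] := cG.
have inv : invariant4 G (\pi_Pic_mod4 (emb c)).
  apply/forall_inP => w wG; rewrite pi_W_act_mod4 -Quotient.idealrBE.
  have [b bE] : exists b : Pic, emb (wact w c - c) = b *+ 4.
    apply: bar_mult4; rewrite barB bar_wact.
    case: (cG1 w wG) => /eqP->; first by left; rewrite subrr.
    by right; rewrite addrC addKr.
  by apply/asboolP; exists b; rewrite -bE raddfB W_act_emb.
exists inv; cbv zeta; rewrite iota_Pic4E; set alpha := \pi_(H1 _ _) _.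
have ca : represents c alpha.
  by exists (MkZ1 (iota_cochain_cocycle inv)) => // s; rewrite -(iota_cochainE inv).
move=> z; rewrite -[z]reprK.
case: (torsion2_dichotomy ca cG (repr z)) => [z2|za].
  exists 0; rewrite mulr0z -[RHS](raddf0 (\pi_(H1_mod_torsion2 G))).
  by apply/pi_torsion2_eq; rewrite subr0.
by exists 1; rewrite mulr1z; apply/pi_torsion2_eq.
Qed.

Lemma zmod_card_mod_torsion2 (G : {group W}) (x : H1 G W_act) :
  x *+ 2 <> 0 -> (forall y, y *+ 2 = 0 \/ (y - x) *+ 2 = 0) ->
  zmod_card (H1_mod_torsion2 G) 2.
Proof.
move=> x2 doubling; pose pi := \pi_(H1_mod_torsion2 G).
have pi0 : pi 0 = 0 by exact: raddf0.
have pix : pi x <> 0 by rewrite -pi0 => /pi_torsion2_eq; rewrite subr0.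
exists (fun q => if q == 0 then ord0 else ord_max).
exists (fun i : 'I_2 => if i == ord0 then 0 else pi x) => [q|i].
  have [->|q0] := eqVneq q 0; first by rewrite eqxx.
  have [y2|yx] := doubling (repr q); last by rewrite -[RHS]reprK; apply/esym/pi_torsion2_eq.
  by case/eqP: q0; rewrite -[LHS]reprK -pi0; apply/pi_torsion2_eq; rewrite subr0.
have [->|i0] := eqVneq i ord0; first by rewrite eqxx.
case: eqP => [/pix//|_]; apply/val_inj; case: i i0 => [[|[|//]] ?] //=.
Qed.

(** The 2-torsion embeds into the subsets of D, and D has one element less than the odd entries and
    zeros of c together, hence at most n + 1. *)
Lemma H1_structure (G : {group W}) c n (x : H1 G W_act) :
  twisted G c -> (#|odds c| + #|zeros c| <= n + 2)%N ->
  x *+ 4 = 0 -> x *+ 2 <> 0 -> (forall y, y *+ 2 = 0 \/ (y - x) *+ 2 = 0) ->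
  exists2 e, (e <= n)%N & zmod_iso (H1 G W_act) ('Z_4 * 'rV['Z_2]_e)%type.
Proof.
move=> cG cn x4 x2 doubling; have [D [h [DE hD hI]]] := torsion2_bound cG.
apply: (zmod_iso_Z4_Z2 x4 x2 doubling (E := powerset D) (h := h)) => //.
  by rewrite card_powerset leq_exp2l // -ltnS DE; lia.
by move=> y /hD; rewrite inE.
Qed.

Definition c_I_int : 'rV[int]_5 := \row_i nth 0 [:: 1; 1; 1; 2; 0] i.
Definition c_II_int : 'rV[int]_5 := \row_i nth 0 [:: 1; 2; 0; 2; 0] i.

Theorem theorem3p30 (G : {group W})
    (hG : exists x : H1 G W_act, has_order x 4) :
  (typeI G \/ typeII G) /\
  ((typeII G -> #|G| = 4%N -> typeI G) /\
   (typeI G -> typeII G -> #|G| = 4%N)) /\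
  (exists e : nat,
     [/\ (e <= 2)%N,
         zmod_iso (H1 G W_act) ('Z_4 * 'rV['Z_2]_e)%type
       & typeII G -> (e <= 1)%N]) /\
  zmod_card (H1_mod_torsion2 G) 2 /\
  (normalised_typeI G ->
     iota_generates G (e_ i1 + e_ i2 + e_ i3 + e_ i4 *+ 2)) /\
  (normalised_typeII G ->
     iota_generates G (e_ i1 + e_ i2 *+ 2 + e_ i4 *+ 2)).
Proof.
have [x [_ x4 xm]] := hG; have x2 : x *+ 2 <> 0 by apply: xm.
have [c cx] := represents_exists x.
have cG := represents_twisted cx x2.
have doubling := torsion2_dichotomy cx cG.
split; first exact: twisted_type cG.
split.
  split=> [/typeII_twisted[d dG d1] G4|/typeI_twisted[d dG d3] /typeII_twisted[d' d'G d1]].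
    by apply/typeI_twisted; apply: (typeII_card4_typeI dG d1 G4).
  exact: typeI_typeII_card dG d'G d3 d1.
split.
  (* One odd entry comes with two zeros, and 1 + 2 gives e <= 1; three odd entries come with one
     zero, and 3 + 1 gives e <= 2. *)
  have [/typeII_twisted[d dG d1]|nII] := pselect (typeII G).
    have /twistedP[_ [w _ /flips_card d02]] := dG.
    have [|e e1 iso] := H1_structure (n := 1) dG _ x4 x2 doubling.
      by have := card_parts d; rewrite d1; lia.
    by exists e; split=> //; apply: leq_trans e1 _.
  have /twistedP[_ [w _ cw]] := cG.
  have [|e e2 iso] := H1_structure (n := 2) cG _ x4 x2 doubling; last by exists e.
  by have := flips_card cw; have := card_parts (bar c); case: (flips_odds_card cw) => ->; lia.
split; first exact: zmod_card_mod_torsion2 doubling.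
have eE i : e_ i = emb (delta_mx 0 i) by apply: val_inj; rewrite /= map_delta_mx.
split=> [/normalised_typeIE|/normalised_typeIIE] GN.
  have -> : e_ i1 + e_ i2 + e_ i3 + e_ i4 *+ 2 = emb c_I_int.
    rewrite !eE -raddfMn -!raddfD; congr emb.
    by apply/rowP; elim/I5_ind; rewrite mulr2n !mxE.
  apply: iota_generates_twisted; rewrite (_ : bar _ = c_I) //.
  by apply/rowP; elim/I5_ind; rewrite !mxE; apply/eqP.
have -> : e_ i1 + e_ i2 *+ 2 + e_ i4 *+ 2 = emb c_II_int.
  rewrite !eE -!raddfMn -!raddfD; congr emb.
  by apply/rowP; elim/I5_ind; rewrite !mulr2n !mxE.
apply: iota_generates_twisted; rewrite (_ : bar _ = c_II) //.
by apply/rowP; elim/I5_ind; rewrite !mxE; apply/eqP.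
Qed.
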